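(* Let $f \in \mathcal{S}_{\mathcal{AP}}^{*}$, $f(z)=z+\sum_{n=2}^{\infty}a_nz^n$. Then the third-order Hermitian-Toeplitz determinant $$T_{3,1}(f)=\begin{vmatrix} 1 & a_2 & a_3\\ \overline{a_2} & 1 & a_2\\ \overline{a_3} & \overline{a_2} & 1\end{vmatrix} = 2\Re\left(a_{2}^{2}\overline{a_{3}}\right) - 2|a_{2}|^{2} - |a_{3}|^{2} + 1$$ satisfies $$-\frac{676}{1295} \leq T_{3,1}(f) \leq \frac{279}{256}.$$ Both bounds are sharp, i.e. each is attained by some function in $\mathcal{S}_{\mathcal{AP}}^{*}$.
   Context: Let $\mathbb{D}=\{z\in\mathbb{C}:|z|<1\}$, and let $\mathcal{A}$ be the class of analytic functions $f$ on $\mathbb{D}$ normalized by $f(0)=0$, $f'(0)=1$, written $f(z)=z+\sum_{n=2}^{\infty}a_nz^n$. For analytic $f,g$ on $\mathbb{D}$, $f\prec g$ (subordination) means that there is an analytic function $\omega$ on $\mathbb{D}$ with $\omega(0)=0$ and $|\omega(z)|<1$ (a Schwarz function) such that $f(z)=g(\omega(z))$ for $z\in\mathbb{D}$. The class $\mathcal{S}_{\mathcal{AP}}^{*}$ consists of all $f\in\mathcal{A}$ with $$\frac{zf'(z)}{f(z)}\prec\psi_{\mathcal{AP}}(z):=e^{z}\sqrt{1+z},\quad z\in\mathbb{D},$$ where the square root is the principal branch (value $1$ at $z=0$). *)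

(* Defs.v *)
From Stdlib Require Import Reals Lra.
From Coquelicot Require Export Coquelicot.
Local Open Scope R_scope.

Definition unit_disk (z : C) : Prop := Cmod z < 1.

(* Analytic on D: complex differentiable at every point of D.  Functions are
   total on C; their values outside D play no role. *)
Definition analytic_on_disk (f : C -> C) : Prop :=
  forall z : C, unit_disk z -> @ex_derive C_AbsRing C_NormedModule f z.

Definition class_A (f : C -> C) : Prop :=
  analytic_on_disk f /\ f 0 = 0 /\ C_derive f 0 = 1.

(* f(z) = sum_n a_n z^n, convergent for every z in D. *)
Definition taylor_coefficients (f : C -> C) (a : nat -> C) : Prop :=
  forall z : C, unit_disk z -> @is_pseries C_AbsRing C_NormedModule a z (f z).

Definition schwarz_function (w : C -> C) : Prop :=
  analytic_on_disk w /\ w 0 = 0 /\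
  (forall z : C, unit_disk z -> Cmod (w z) < 1).

Definition subordinate (f g : C -> C) : Prop :=
  exists w : C -> C, schwarz_function w /\
    forall z : C, unit_disk z -> f z = g (w z).

Definition Cexp (z : C) : C :=
  (exp (Re z) * cos (Im z), exp (Re z) * sin (Im z)).

(* Principal branch, in Cartesian form; on the negative real axis it takes the
   value with nonnegative imaginary part. *)
Definition Csqrt (z : C) : C :=
  (sqrt ((Cmod z + Re z) / 2),
   if Rlt_dec (Im z) 0 then - sqrt ((Cmod z - Re z) / 2)
   else sqrt ((Cmod z - Re z) / 2)).

Lemma Csqrt_sqr (z : C) : (Csqrt z * Csqrt z)%C = z.
Proof.
  destruct z as [x y]; unfold Csqrt, Cmult; simpl.
  assert (Hx : Rabs x <= Cmod (x, y)) by exact (re_le_Cmod (x, y)).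
  apply Rabs_le_between in Hx.
  assert (H2 : Cmod (x, y) * Cmod (x, y) = x * x + y * y).
  { unfold Cmod; simpl; rewrite sqrt_sqrt; nra. }
  set (m := Cmod (x, y)) in *.
  assert (Hp : 0 <= (m + x) / 2) by lra.
  assert (Hm : 0 <= (m - x) / 2) by lra.
  assert (HM : sqrt ((m + x) / 2) * sqrt ((m - x) / 2) = Rabs y / 2).
  { rewrite <- sqrt_mult by assumption.
    replace ((m + x) / 2 * ((m - x) / 2)) with (Rsqr (y / 2))
      by (unfold Rsqr; nra).
    rewrite sqrt_Rsqr_abs; unfold Rdiv; rewrite Rabs_mult.
    rewrite (Rabs_pos_eq (/ 2)); lra. }
  assert (Hp' := sqrt_sqrt _ Hp); assert (Hm' := sqrt_sqrt _ Hm).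
  destruct (Rlt_dec y 0).
  - rewrite Rabs_left in HM by assumption.
    apply injective_projections; simpl; nra.
  - rewrite Rabs_pos_eq in HM by lra.
    apply injective_projections; simpl; nra.
Qed.

Lemma Csqrt_Re_ge0 (z : C) : 0 <= Re (Csqrt z).
Proof. apply sqrt_pos. Qed.

Definition psi_AP (z : C) : C := (Cexp z * Csqrt (1 + z))%C.

(* z f'(z) / f(z), with its removable singularity at 0 filled in (f(0) = 0 and
   f'(0) = 1).  If f has a zero z <> 0 in D then the totalized division gives 0
   there, a value psi_AP does not take on D, so such f are not in class_SAP. *)
Definition starlike_quotient (f : C -> C) (z : C) : C :=
  if Ceq_dec z 0 then RtoC 1 else (z * C_derive f z / f z)%C.

Definition class_SAP (f : C -> C) : Prop :=
  class_A f /\ subordinate (starlike_quotient f) psi_AP.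

Definition det3 (m11 m12 m13 m21 m22 m23 m31 m32 m33 : C) : C :=
  (m11 * (m22 * m33 - m23 * m32)
   - m12 * (m21 * m33 - m23 * m31)
   + m13 * (m21 * m32 - m22 * m31))%C.

Definition T31 (a : nat -> C) : C :=
  det3 1                (a 2%nat)        (a 3%nat)
       (Cconj (a 2%nat)) 1               (a 2%nat)
       (Cconj (a 3%nat)) (Cconj (a 2%nat)) 1.

(* Main.v *)
(* Write z f'(z)/f(z) = psi(w(z)) with w(z) = c1 z + c2 z^2 + ... a Schwarz
   function.  Differentiating f'/(f/z) = psi(w) at 0 gives a2 = (3/2) c1 and
   a3 = (3/4) c2 + (25/16) c1^2, whence, with x = |c1|^2 and y = |c2|,
     T31 = 1 - (9/2) x + (1175/256) x^2 + (33/32) Re(c1^2 conj c2) - (9/16) y^2,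
   and the constraint x + y <= 1 leaves an elementary optimization.  The minimum
   is at y = 1 - x, x = 564/1295, with c1^2 and c2 of opposite directions; the
   maximum is at x = 1.  Both come from w(z) = z (c - z)/(1 - c z), which is z
   itself for c = 1.

   The constraint x + y <= 1 follows from Bessel's inequality on the circles
   |z| = r for the function w(z) (u + v z/r), dominated there by u + v z/r.

   Taylor expansions come from Cauchy's formula for functions with a continuous
   complex derivative, proved by contracting the circle to the point z; no
   Goursat argument is needed, because w' = p'/psi'(w) with p = z f'/f, and f is
   a power series, so that w' is continuous.  *)
Require Import Defs.
From Stdlib Require Import Reals Lra Lia Psatz.
From Coquelicot Require Import Coquelicot.
Local Open Scope R_scope.

(** * Complex differentiation *)

(** Contracting the circle differentiates under the integral sign, and this is where continuity of
    the derivative enters. The circle integral stays constant because, for the Cauchy kernel, the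
    derivative of the integrand in the contraction parameter is also a derivative in the angle,
    whose integral over a period vanishes.

    The multiplier u + v z/r in Bessel's inequality tests the lower triangular Toeplitz matrix with
    rows (c1, 0) and (c2, c1), scaled by the radius, as a contraction on pairs (u, v). Its norm
    bound is |c2| <= 1 - |c1|^2. This route needs neither the maximum principle nor the division of
    w by z.

    All integrals are Riemann integrals of real functions. A complex mean is assembled from the real
    parts of g and of -i g, so most identities are proved once for real parts and applied twice.

    For sharpness, f is recovered from w as z exp(h) with h' = (psi(w) - 1)/z, so only one
    antiderivative of a power series has to be built. *)

Definition Ccont (f : C -> C) (z : C) : Prop :=
  forall eps, 0 < eps -> exists d, 0 < d /\
    forall w, Cmod (w - z) < d -> Cmod (f w - f z) < eps.

Lemma Ccont_const (c z : C) : Ccont (fun _ => c) z.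
Proof.
intros e He; exists 1; split; [lra|]; intros w _.
replace (c - c)%C with (RtoC 0) by ring; rewrite Cmod_0; exact He.
Qed.

Lemma Ccont_id (z : C) : Ccont (fun w => w) z.
Proof. intros e He; exists e; split; [exact He|]; intros w Hw; exact Hw. Qed.

Lemma Ccont_plus (f g : C -> C) (z : C) :
  Ccont f z -> Ccont g z -> Ccont (fun w => f w + g w)%C z.
Proof.
intros Hf Hg e He.
destruct (Hf (e / 2)) as [d1 [P1 H1]]; [lra|].
destruct (Hg (e / 2)) as [d2 [P2 H2]]; [lra|].
exists (Rmin d1 d2); split; [apply Rmin_pos; assumption|]; intros w Hw.
replace (f w + g w - (f z + g z))%C with ((f w - f z) + (g w - g z))%C by ring.
apply Rle_lt_trans with (1 := Cmod_triangle _ _).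
assert (A := H1 w (Rlt_le_trans _ _ _ Hw (Rmin_l _ _))).
assert (B := H2 w (Rlt_le_trans _ _ _ Hw (Rmin_r _ _))).
lra.
Qed.

Lemma Ccont_mult (f g : C -> C) (z : C) :
  Ccont f z -> Ccont g z -> Ccont (fun w => f w * g w)%C z.
Proof.
intros Hf Hg e He.
set (M := Cmod (f z) + Cmod (g z) + 1).
assert (F0 := Cmod_ge_0 (f z)); assert (G0 := Cmod_ge_0 (g z)).
assert (Em : 0 < e / (2 * M)) by (apply Rdiv_lt_0_compat; unfold M; lra).
destruct (Hf (Rmin 1 (e / (2 * M)))) as [d1 [P1 H1]]; [apply Rmin_pos; lra|].
destruct (Hg (e / (2 * M))) as [d2 [P2 H2]]; [lra|].
exists (Rmin d1 d2); split; [apply Rmin_pos; assumption|]; intros w Hw.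
assert (A := H1 w (Rlt_le_trans _ _ _ Hw (Rmin_l _ _))).
assert (B := H2 w (Rlt_le_trans _ _ _ Hw (Rmin_r _ _))).
assert (A1 := Rlt_le_trans _ _ _ A (Rmin_l _ _)).
assert (A2 := Rlt_le_trans _ _ _ A (Rmin_r _ _)).
replace (f w * g w - f z * g z)%C
  with ((f w - f z) * (g w - g z) + f z * (g w - g z) + (f w - f z) * g z)%C
  by ring.
apply Rle_lt_trans with (1 := Cmod_triangle _ _).
apply Rle_lt_trans with
  (1 := Rplus_le_compat_r _ _ _ (Cmod_triangle _ _)).
rewrite !Cmod_mult.
assert (C0 := Cmod_ge_0 (f w - f z)); assert (D0 := Cmod_ge_0 (g w - g z)).
set (x := e / (2 * M)) in *.
assert (Hx : e = 2 * M * x) by (unfold x; field; unfold M; lra).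
rewrite Hx; unfold M in *; nra.
Qed.

Lemma Ccont_comp (f g : C -> C) (z : C) :
  Ccont f z -> Ccont g (f z) -> Ccont (fun w => g (f w)) z.
Proof.
intros Hf Hg e He.
destruct (Hg e He) as [d1 [P1 H1]].
destruct (Hf d1 P1) as [d [P H]].
exists d; split; [exact P|]; intros w Hw; apply H1, H, Hw.
Qed.

Lemma Ccont_ext_loc (f g : C -> C) (z : C) (r : R) :
  0 < r -> (forall w, Cmod (w - z) < r -> f w = g w) -> Ccont f z -> Ccont g z.
Proof.
intros Hr E Hf e He.
destruct (Hf e He) as [d [P H]].
exists (Rmin d r); split; [apply Rmin_pos; assumption|]; intros w Hw.
rewrite <- !E.
- apply H; exact (Rlt_le_trans _ _ _ Hw (Rmin_l _ _)).
- replace (z - z)%C with (RtoC 0) by ring; rewrite Cmod_0; exact Hr.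
- exact (Rlt_le_trans _ _ _ Hw (Rmin_r _ _)).
Qed.

Lemma Cmod_minus_ge (a b : C) : Cmod a - Cmod b <= Cmod (a - b).
Proof.
assert (H := Cmod_triangle (a - b) b).
replace (a - b + b)%C with a in H by ring; lra.
Qed.

Lemma Cmod_minus_sym (a b : C) : Cmod (a - b) = Cmod (b - a).
Proof. rewrite <- Cmod_opp; f_equal; ring. Qed.

Lemma Ccont_Cinv (z : C) : z <> 0%R -> Ccont Cinv z.
Proof.
intros Hz e He.
assert (P : 0 < Cmod z) by (apply Cmod_gt_0; exact Hz).
set (m := Cmod z) in *.
exists (Rmin (m / 2) (e * (m * m) / 2)); split.
{ apply Rmin_pos; [lra|]. apply Rdiv_lt_0_compat; [apply Rmult_lt_0_compat; [|apply Rmult_lt_0_compat]; assumption|lra]. }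
intros w Hw.
assert (A := Rlt_le_trans _ _ _ Hw (Rmin_l _ _)).
assert (B := Rlt_le_trans _ _ _ Hw (Rmin_r _ _)).
assert (L := Cmod_minus_ge z w); rewrite Cmod_minus_sym in L; fold m in L.
assert (W : w <> 0%R) by (apply Cmod_gt_0; lra).
replace (/ w - / z)%C with ((z - w) * / (w * z))%C by (field; split; assumption).
assert (0 < Cmod w) by lra.
rewrite Cmod_mult, Cmod_minus_sym, Cmod_inv, Cmod_mult by (apply Cmult_neq_0; assumption).
fold m.
apply Rmult_lt_reg_r with (Cmod w * m); [nra|].
rewrite Rmult_assoc, Rinv_l, Rmult_1_r by (apply Rgt_not_eq, Rmult_lt_0_compat; lra).
assert (0 < e * m * (Cmod w - m / 2))
  by (apply Rmult_lt_0_compat; [apply Rmult_lt_0_compat|]; lra).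
lra.
Qed.

(* Caratheodory's form of complex differentiability: the product, chain and
   quotient rules reduce to algebra of continuous functions. *)
Definition Cderiv (f : C -> C) (z l : C) : Prop :=
  exists phi, Ccont phi z /\ phi z = l /\
    forall w, (f w - f z)%C = (phi w * (w - z))%C.

Lemma Cderiv_iff_eps (f : C -> C) (z l : C) :
  Cderiv f z l <->
  forall eps, 0 < eps -> exists d, 0 < d /\ forall w, Cmod (w - z) < d ->
    Cmod (f w - f z - l * (w - z)) <= eps * Cmod (w - z).
Proof.
split.
- intros [phi [Hc [Hl Hf]]] e He.
  destruct (Hc e He) as [d [P H]]; exists d; split; [exact P|]; intros w Hw.
  rewrite Hf, <- Hl.
  replace (phi w * (w - z) - phi z * (w - z))%C
    with ((phi w - phi z) * (w - z))%C by ring.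
  rewrite Cmod_mult; apply Rmult_le_compat_r; [apply Cmod_ge_0|].
  left; apply H, Hw.
- intros H.
  (* The difference quotient, completed at z by the only value that makes it continuous there. *)
  exists (fun w => if Ceq_dec w z then l else ((f w - f z) / (w - z))%C).
  assert (Ez : (if Ceq_dec z z then l else ((f z - f z) / (z - z))%C) = l).
  { destruct (Ceq_dec z z) as [_|N]; [reflexivity|now elim N]. }
  split; [|split]; [|exact Ez|].
  + intros e He; destruct (H (e / 2)) as [d [P Hd]]; [lra|].
    exists d; split; [exact P|]; intros w Hw; rewrite Ez.
    destruct (Ceq_dec w z) as [_|N].
    * replace (l - l)%C with (RtoC 0) by ring; rewrite Cmod_0; exact He.
    * assert (W : (w - z)%C <> 0%R).
      { intro K; apply N; replace w with (w - z + z)%C by ring; rewrite K; ring. }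
      assert (0 < Cmod (w - z)) by (apply Cmod_gt_0; exact W).
      replace ((f w - f z) / (w - z) - l)%C
        with ((f w - f z - l * (w - z)) / (w - z))%C by (field; exact W).
      rewrite Cmod_div by exact W.
      apply Rle_lt_trans with (e / 2); [|lra].
      apply Rmult_le_reg_r with (Cmod (w - z)); [assumption|].
      unfold Rdiv at 1; rewrite Rmult_assoc, Rinv_l by lra.
      rewrite Rmult_1_r; apply Hd, Hw.
  + intros w; destruct (Ceq_dec w z) as [->|N]; [ring|].
    field; intro K; apply N; replace w with (w - z + z)%C by ring; rewrite K; ring.
Qed.

Lemma Cderiv_is_derive (f : C -> C) (z l : C) :
  Cderiv f z l <-> @is_derive C_AbsRing C_NormedModule f z l.
Proof.
rewrite Cderiv_iff_eps; split.
- intros H; split; [apply is_linear_scal_l|].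
  intros x Hx.
  rewrite <- (@is_filter_lim_locally_unique C_AbsRing
                (AbsRing_NormedModule C_AbsRing) z x Hx).
  intros [e He]; destruct (H e He) as [d [P Hd]].
  exists (mkposreal d P); intros y Hy.
  assert (E : @norm C_AbsRing C_NormedModule (minus (minus (f y) (f z))
                (scal (minus y z) l)) = Cmod (f y - f z - l * (y - z))).
  { change (Cmod ((f y - f z) + - ((y - z) * l)) = Cmod (f y - f z - l * (y - z))).
    f_equal; ring. }
  apply Rle_trans with (1 := Req_le _ _ E); apply Hd, Hy.
- intros [_ H] e He.
  destruct (H z (fun P HP => HP) (mkposreal e He)) as [[d P] Hd].
  exists d; split; [exact P|]; intros w Hw.
  assert (E : @norm C_AbsRing C_NormedModule (minus (minus (f w) (f z))
                (scal (minus w z) l)) = Cmod (f w - f z - l * (w - z))).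
  { change (Cmod ((f w - f z) + - ((w - z) * l)) = Cmod (f w - f z - l * (w - z))).
    f_equal; ring. }
  apply Rle_trans with (1 := Req_le _ _ (eq_sym E)); apply (Hd w), Hw.
Qed.

Lemma Cderiv_C_derive (f : C -> C) (z l : C) : Cderiv f z l -> C_derive f z = l.
Proof. intro H; apply is_C_derive_unique, Cderiv_is_derive, H. Qed.

Lemma Cderiv_unique (f : C -> C) (z l1 l2 : C) : Cderiv f z l1 -> Cderiv f z l2 -> l1 = l2.
Proof.
intros H1 H2; rewrite <- (Cderiv_C_derive _ _ _ H1); apply Cderiv_C_derive, H2.
Qed.

Lemma Cderiv_Ccont (f : C -> C) (z l : C) : Cderiv f z l -> Ccont f z.
Proof.
intros [phi [Hc [_ Hf]]].
apply (Ccont_ext_loc (fun w => f z + phi w * (w - z))%C f z 1); [lra| |].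
- intros w _; rewrite <- Hf; ring.
- apply Ccont_plus; [apply Ccont_const|].
  apply Ccont_mult; [exact Hc|].
  apply Ccont_plus; [apply Ccont_id|apply Ccont_const].
Qed.

Lemma Cderiv_eq (f : C -> C) (z l l' : C) : l = l' -> Cderiv f z l -> Cderiv f z l'.
Proof. now intros ->. Qed.

Lemma Cderiv_ext_loc (f g : C -> C) (z l : C) (r : R) :
  0 < r -> (forall w, Cmod (w - z) < r -> f w = g w) -> Cderiv f z l -> Cderiv g z l.
Proof.
rewrite !Cderiv_iff_eps; intros Hr E H e He.
destruct (H e He) as [d [P Hd]].
exists (Rmin d r); split; [apply Rmin_pos; assumption|]; intros w Hw.
rewrite <- !E.
- apply Hd; exact (Rlt_le_trans _ _ _ Hw (Rmin_l _ _)).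
- replace (z - z)%C with (RtoC 0) by ring; rewrite Cmod_0; exact Hr.
- exact (Rlt_le_trans _ _ _ Hw (Rmin_r _ _)).
Qed.

Lemma Cderiv_const (c z : C) : Cderiv (fun _ => c) z 0.
Proof.
exists (fun _ => RtoC 0); split; [apply Ccont_const|split; [reflexivity|]].
intros w; ring.
Qed.

Lemma Cderiv_id (z : C) : Cderiv (fun w => w) z 1.
Proof.
exists (fun _ => RtoC 1); split; [apply Ccont_const|split; [reflexivity|]].
intros w; ring.
Qed.

Lemma Cderiv_plus (f g : C -> C) (z l m : C) :
  Cderiv f z l -> Cderiv g z m -> Cderiv (fun w => f w + g w)%C z (l + m)%C.
Proof.
intros [p [Cp [Vp Ep]]] [q [Cq [Vq Eq]]].
exists (fun w => p w + q w)%C; split; [apply Ccont_plus; assumption|].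
split; [now rewrite Vp, Vq|]; intros w.
replace (f w + g w - (f z + g z))%C with ((f w - f z) + (g w - g z))%C by ring.
rewrite Ep, Eq; ring.
Qed.

Lemma Cderiv_mult (f g : C -> C) (z l m : C) :
  Cderiv f z l -> Cderiv g z m -> Cderiv (fun w => f w * g w)%C z (l * g z + f z * m)%C.
Proof.
intros Hf Hg; assert (Cg := Cderiv_Ccont _ _ _ Hg).
destruct Hf as [p [Cp [Vp Ep]]]; destruct Hg as [q [Cq [Vq Eq]]].
exists (fun w => p w * g w + f z * q w)%C; split; [|split].
- apply Ccont_plus; apply Ccont_mult; try assumption; apply Ccont_const.
- now rewrite Vp, Vq.
- intros w.
  replace (f w * g w - f z * g z)%C
    with ((f w - f z) * g w + f z * (g w - g z))%C by ring.
  rewrite Ep, Eq; ring.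
Qed.

Lemma Cderiv_comp (f g : C -> C) (z l m : C) :
  Cderiv f z l -> Cderiv g (f z) m -> Cderiv (fun w => g (f w)) z (m * l)%C.
Proof.
intros Hf Hg; assert (Cf := Cderiv_Ccont _ _ _ Hf).
destruct Hf as [p [Cp [Vp Ep]]]; destruct Hg as [q [Cq [Vq Eq]]].
exists (fun w => q (f w) * p w)%C; split; [|split].
- apply Ccont_mult; [apply Ccont_comp|]; assumption.
- now rewrite Vp, Vq.
- intros w; rewrite Eq, Ep; ring.
Qed.

(** With slope [- / z * / w], Caratheodory's identity for [Cinv] fails at w = 0, where [/ 0] is 0. A
    function having this slope everywhere is differentiated instead and then exchanged for [Cinv] on
    a ball around z that avoids 0. *)
Lemma Cderiv_Cinv (z : C) : z <> 0%R -> Cderiv Cinv z (- / (z * z))%C.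
Proof.
intros Hz.
assert (P : 0 < Cmod z) by (apply Cmod_gt_0; exact Hz).
assert (N : forall w, Cmod (w - z) < Cmod z -> w <> 0%R).
{ intros w Hw E; rewrite E in Hw.
  replace (0 - z)%C with (- z)%C in Hw by ring; rewrite Cmod_opp in Hw; lra. }
apply Cderiv_iff_eps.
assert (Hc : Cderiv (fun w => 1 * / z + (w - z) * (- / z * / w))%C z (- / (z * z))%C).
{ exists (fun w => - / z * / w)%C; split; [|split].
  - apply Ccont_mult; [apply Ccont_const|apply Ccont_Cinv, Hz].
  - field; exact Hz.
  - intros w; ring. }
apply Cderiv_iff_eps.
apply (Cderiv_ext_loc _ _ _ _ _ P) with (2 := Hc).
intros w Hw; field; split; [apply N, Hw|exact Hz].
Qed.

Lemma Cderiv_opp (f : C -> C) (z l : C) : Cderiv f z l -> Cderiv (fun w => - f w)%C z (- l)%C.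
Proof.
intros [p [Cp [Vp Ep]]].
exists (fun w => -(1) * p w)%C; split; [apply Ccont_mult; [apply Ccont_const|exact Cp]|].
split; [rewrite Vp; ring|]; intros w.
replace (- f w - - f z)%C with (- (f w - f z))%C by ring; rewrite Ep; ring.
Qed.

Lemma Cderiv_minus (f g : C -> C) (z l m : C) :
  Cderiv f z l -> Cderiv g z m -> Cderiv (fun w => f w - g w)%C z (l - m)%C.
Proof. intros Hf Hg; exact (Cderiv_plus _ _ _ _ _ Hf (Cderiv_opp _ _ _ Hg)). Qed.

Lemma Cderiv_inv (f : C -> C) (z l : C) :
  f z <> 0%R -> Cderiv f z l -> Cderiv (fun w => / f w)%C z (- l / (f z * f z))%C.
Proof.
intros N Hf; apply Cderiv_eq with (2 := Cderiv_comp _ _ _ _ _ Hf (Cderiv_Cinv _ N)).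
field; exact N.
Qed.

Lemma Cderiv_div (f g : C -> C) (z l m : C) :
  g z <> 0%R -> Cderiv f z l -> Cderiv g z m ->
  Cderiv (fun w => f w / g w)%C z ((l * g z - f z * m) / (g z * g z))%C.
Proof.
intros N Hf Hg; apply Cderiv_eq with (2 := Cderiv_mult _ _ _ _ _ Hf (Cderiv_inv _ _ _ N Hg)).
field; exact N.
Qed.

(** * Complex power series *)

Definition Cseries (u : nat -> C) (l : C) : Prop := @is_series C_AbsRing C_NormedModule u l.

Lemma Cseries_le (u : nat -> C) (b : nat -> R) (l : C) (s : R) :
  (forall n, Cmod (u n) <= b n) -> Cseries u l -> is_series b s -> Cmod l <= s.
Proof.
intros H Hu Hb.
apply (is_lim_seq_le (fun n => Cmod (@sum_n C_AbelianMonoid u n)) (sum_n b) (Cmod l) s).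
- intros n; induction n as [|n IH].
  + rewrite !sum_O; apply H.
  + rewrite !sum_Sn; apply Rle_trans with (1 := Cmod_triangle _ _).
    apply Rplus_le_compat; [exact IH|apply H].
- exact (filterlim_comp _ _ _ _ _ _ _ _ Hu (@filterlim_norm C_AbsRing C_NormedModule l)).
- exact Hb.
Qed.

Lemma Cseries_ext (u v : nat -> C) (l : C) : (forall n, u n = v n) -> Cseries u l -> Cseries v l.
Proof. exact (is_series_ext u v l). Qed.

Lemma Cseries_unique (u : nat -> C) (l m : C) : Cseries u l -> Cseries u m -> l = m.
Proof. exact (filterlim_locally_unique (V := C_NormedModule) _ l m). Qed.

Lemma Cseries_scal (c : C) (u : nat -> C) (l : C) : Cseries u l -> Cseries (fun n => c * u n)%C (c * l)%C.
Proof. exact (is_series_scal_l (V := C_NormedModule) c u l). Qed.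

Lemma Cseries_minus (u v : nat -> C) (l m : C) :
  Cseries u l -> Cseries v m -> Cseries (fun n => u n - v n)%C (l - m)%C.
Proof. exact (is_series_minus (V := C_NormedModule) u v l m). Qed.

Lemma Cseries_tail (u : nat -> C) (l : C) : Cseries u l -> Cseries (fun n => u (S n)) (l - u 0%nat)%C.
Proof.
intros H; apply (is_series_incr_1 (V := C_NormedModule) u).
change (Cseries u (l - u 0%nat + u 0%nat)%C).
replace (l - u 0%nat + u 0%nat)%C with l by ring; exact H.
Qed.

Lemma Cseries_cons (u : nat -> C) (l : C) : Cseries (fun n => u (S n)) (l - u 0%nat)%C -> Cseries u l.
Proof. exact (is_series_decr_1 (V := C_NormedModule) u l). Qed.

Lemma Cseries_term_bounded (u : nat -> C) (l : C) :
  Cseries u l -> exists B, 0 < B /\ forall n, Cmod (u n) <= B.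
Proof.
intros H.
assert (L : is_lim_seq (fun n => Cmod (@sum_n C_AbelianMonoid u n)) (Cmod l))
  by exact (filterlim_comp _ _ _ _ _ _ _ _ H (@filterlim_norm C_AbsRing C_NormedModule l)).
destruct (filterlim_bounded (V := R_NormedModule) _ (ex_intro _ (Cmod l) L)) as [M HM].
assert (HM' : forall n, Cmod (@sum_n C_AbelianMonoid u n) <= M).
{ intros n; apply Rle_trans with (2 := HM n), Rle_abs. }
assert (M0 := Rle_trans _ _ _ (Cmod_ge_0 _) (HM' 0%nat)).
exists (M + M + 1); split; [lra|]; intros [|n].
- assert (A := HM' 0%nat); rewrite sum_O in A; lra.
- assert (A := HM' n); assert (B := HM' (S n)); rewrite sum_Sn in B.
  set (s := @sum_n C_AbelianMonoid u n) in *.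
  change (plus s (u (S n))) with (s + u (S n))%C in B.
  assert (K := Cmod_triangle (s + u (S n)) (- s)); rewrite Cmod_opp in K.
  replace (s + u (S n) + - s)%C with (u (S n)) in K by ring; lra.
Qed.

Lemma pow_n_Cpow (z : C) (n : nat) : @pow_n C_AbsRing z n = (z ^ n)%C.
Proof. induction n as [|n IH]; [reflexivity|]; simpl; rewrite IH; reflexivity. Qed.

Lemma pseries_Cseries (a : nat -> C) (z l : C) :
  @is_pseries C_AbsRing C_NormedModule a z l <-> Cseries (fun n => a n * z ^ n)%C l.
Proof.
assert (E : forall n, @scal _ C_NormedModule (pow_n z n) (a n) = (a n * z ^ n)%C).
{ intros n; rewrite pow_n_Cpow; change (z ^ n * a n = a n * z ^ n)%C; ring. }
split; apply (is_series_ext (V := C_NormedModule)); [exact E|].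
intros n; symmetry; apply E.
Qed.

Lemma ex_Cseries_le (u : nat -> C) (b : nat -> R) :
  (forall n, Cmod (u n) <= b n) -> ex_series b -> exists l, Cseries u l.
Proof. exact (@ex_series_le C_AbsRing C_CompleteNormedModule u b). Qed.

(** The second derivative of the geometric series. Its weights are those of [Cpow_linear_remainder],
    so it majorizes the error of termwise differentiation. *)
Lemma ex_series_quadratic_geom (q : R) :
  0 <= q < 1 -> ex_series (fun n => INR (S n) * INR (S (S n)) * q ^ n).
Proof.
intros Hq.
assert (HR : CV_radius (fun _ => 1) = Finite 1).
{ rewrite (CV_radius_finite_DAlembert _ 1).
  - simpl; f_equal; lra.
  - intros _; lra.
  - lra.
  - apply is_lim_seq_ext with (fun _ => 1); [|apply is_lim_seq_const].
    intros _; rewrite Rabs_pos_eq; lra. }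
assert (H : ex_pseries (PS_derive (PS_derive (fun _ => 1))) q).
{ apply ex_pseries_derive; rewrite CV_radius_derive, HR.
  simpl; rewrite Rabs_pos_eq; lra. }
apply ex_pseries_R in H; apply ex_series_ext with (2 := H); intros n.
unfold PS_derive; rewrite Rmult_1_r; reflexivity.
Qed.

Definition derivative_coef (a : nat -> C) (n : nat) : C := (RtoC (INR (S n)) * a (S n))%C.

Lemma taylor_coef_bound (f : C -> C) (a : nat -> C) (r : R) :
  taylor_coefficients f a -> 0 < r < 1 ->
  exists B, 0 < B /\ forall n, Cmod (a n) <= B / r ^ n.
Proof.
intros H Hr.
assert (D : unit_disk r) by (unfold unit_disk; rewrite Cmod_R, Rabs_pos_eq; lra).
assert (HS := H _ D); apply pseries_Cseries, Cseries_term_bounded in HS.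
destruct HS as [B [PB HB]]; exists B; split; [exact PB|]; intros n.
assert (P := pow_lt r n (proj1 Hr)).
specialize (HB n); rewrite Cmod_mult, Cmod_pow, Cmod_R, Rabs_pos_eq in HB by lra.
apply Rmult_le_reg_r with (r ^ n); [exact P|].
unfold Rdiv; rewrite Rmult_assoc, Rinv_l by lra; lra.
Qed.

(** The remainders satisfy E(n+1) = w E(n) + (n+1) z^n (w - z)^2. The extra factor r on the left
    avoids the exponent n - 1 on the right. *)
Lemma Cpow_linear_remainder (z w : C) (r : R) (n : nat) :
  Cmod z <= r -> Cmod w <= r ->
  Cmod (w ^ S n - z ^ S n - RtoC (INR (S n)) * z ^ n * (w - z)) * r
  <= INR (S n) * INR (S (S n)) * r ^ n * Cmod (w - z) ^ 2.
Proof.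
intros Hz Hw.
assert (Z0 := Cmod_ge_0 z); assert (W0 := Cmod_ge_0 w).
assert (H2 := pow2_ge_0 (Cmod (w - z))).
induction n as [|n IH].
- replace (w ^ 1 - z ^ 1 - INR 1 * z ^ 0 * (w - z))%C with (RtoC 0)
    by (simpl; ring).
  rewrite Cmod_0; simpl (INR _); simpl (r ^ 0); lra.
- set (E := (w ^ S n - z ^ S n - RtoC (INR (S n)) * z ^ n * (w - z))%C) in *.
  replace (w ^ S (S n) - z ^ S (S n) - RtoC (INR (S (S n))) * z ^ S n * (w - z))%C
    with (w * E + RtoC (INR (S n)) * z ^ n * (w - z) ^ 2)%C.
  2:{ unfold E; rewrite (S_INR (S n)), RtoC_plus; simpl Cpow; ring. }
  assert (I1 := pos_INR (S n)).
  assert (I3 : INR (S (S n)) = INR (S n) + 1) by apply S_INR.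
  assert (I4 : INR (S (S (S n))) = INR (S n) + 2) by (rewrite S_INR, I3; ring).
  assert (Rn := pow_le r n (Rle_trans _ _ _ Z0 Hz)).
  assert (Zn : Cmod z ^ n <= r ^ n) by (apply pow_incr; split; assumption).
  set (h := Cmod (w - z)) in *.
  apply Rle_trans with ((r * Cmod E + INR (S n) * r ^ n * h ^ 2) * r).
  + apply Rmult_le_compat_r; [lra|].
    apply Rle_trans with (1 := Cmod_triangle _ _).
    rewrite !Cmod_mult, !Cmod_pow, Cmod_R, Rabs_pos_eq by exact I1.
    fold h; apply Rplus_le_compat.
    * apply Rmult_le_compat_r; [apply Cmod_ge_0|exact Hw].
    * apply Rmult_le_compat_r; [exact H2|].
      apply Rmult_le_compat_l; assumption.
  + replace (r ^ S n) with (r * r ^ n) by reflexivity.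
    apply Rle_trans with
      (r * (INR (S n) * INR (S (S n)) * r ^ n * h ^ 2) + INR (S n) * r ^ n * h ^ 2 * r).
    * replace ((r * Cmod E + INR (S n) * r ^ n * h ^ 2) * r)
        with (r * (Cmod E * r) + INR (S n) * r ^ n * h ^ 2 * r) by ring.
      apply Rplus_le_compat_r, Rmult_le_compat_l; [lra|exact IH].
    * rewrite I4, I3.
      assert (0 <= r * r ^ n * h ^ 2)
        by (apply Rmult_le_pos; [apply Rmult_le_pos|]; lra).
      set (k := r * r ^ n * h ^ 2) in *; set (m := INR (S n)) in *.
      replace (r * (m * (m + 1) * r ^ n * h ^ 2) + m * r ^ n * h ^ 2 * r)
        with ((m * (m + 2)) * k) by (unfold k; ring).
      replace ((m + 1) * (m + 2) * (r * r ^ n) * h ^ 2)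
        with ((m + 1) * (m + 2) * k) by (unfold k; ring).
      apply Rmult_le_compat_r; [assumption|nra].
Qed.

(** Termwise differentiation: the remainder of the whole series is bounded termwise by a multiple of
    |w - z|^2, with a convergent sum of constants. *)
Lemma taylor_derivative_exists (f : C -> C) (a : nat -> C) (z : C) :
  taylor_coefficients f a -> unit_disk z ->
  exists l, Cseries (fun n => derivative_coef a n * z ^ n)%C l /\ Cderiv f z l.
Proof.
intros Ha Hz; unfold unit_disk in Hz; assert (Z0 := Cmod_ge_0 z).
(* Two radii with |z| < r < s < 1: coefficients are bounded at s, the points w stay within r, and q
   = r/s gives geometric decay. *)
set (r := (1 + 2 * Cmod z) / 3); set (s := (2 + Cmod z) / 3).
assert (Hr : Cmod z < r < s) by (unfold r, s; lra).
assert (Hs : 0 < s < 1) by (unfold s; lra).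
assert (r0 : 0 < r) by lra.
destruct (taylor_coef_bound f a s Ha Hs) as [B [B0 HB]].
set (q := r / s).
assert (Hq : 0 <= q < 1).
{ unfold q; split; [apply Rdiv_le_0_compat; lra|].
  apply Rmult_lt_reg_r with s; [lra|].
  unfold Rdiv; rewrite Rmult_assoc, Rinv_l; lra. }
destruct (ex_series_quadratic_geom q Hq) as [T HT].
assert (Eq : forall n, B / s ^ S n * r ^ n = B / s * q ^ n).
{ intros n; unfold q, Rdiv; rewrite Rpow_mult_distr, pow_inv; simpl pow; field.
  split; [apply pow_nonzero|]; lra. }
assert (CL : exists l, Cseries (fun n => derivative_coef a n * z ^ n)%C l).
{ apply ex_Cseries_le with (fun n => B / s * (INR (S n) * INR (S (S n)) * q ^ n)).
  2:{ exists (scal (B / s) T); exact (is_series_scal_l (V := R_NormedModule) (B / s) _ _ HT). }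
  intros n; unfold derivative_coef.
  assert (I1 := pos_INR (S n)).
  assert (I3 : INR (S (S n)) = INR (S n) + 1) by apply S_INR.
  rewrite !Cmod_mult, Cmod_pow, Cmod_R, Rabs_pos_eq by exact I1.
  apply Rle_trans with (INR (S n) * (B / s ^ S n * r ^ n)).
  - rewrite Rmult_assoc; apply Rmult_le_compat_l; [exact I1|].
    apply Rmult_le_compat; [apply Cmod_ge_0|apply pow_le, Cmod_ge_0|apply HB|].
    apply pow_incr; lra.
  - rewrite Eq.
    assert (0 <= B / s * q ^ n).
    { apply Rmult_le_pos; [apply Rdiv_le_0_compat; lra|apply pow_le; lra]. }
    rewrite I3; set (k := B / s * q ^ n) in *; set (m := INR (S n)) in *.
    replace (B / s * (m * (m + 1) * q ^ n)) with (m * (m + 1) * k) by (unfold k; ring).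
    apply Rmult_le_compat_r; [assumption|].
    assert (1 <= m) by (unfold m; rewrite S_INR; assert (J := pos_INR n); lra); nra. }
destruct CL as [l Hl]; exists l; split; [exact Hl|].
apply Cderiv_iff_eps; intros e He.
set (K := B / s * (Rabs T + 1) / r).
assert (TA := Rabs_pos T).
assert (K0 : 0 < K).
{ unfold K; apply Rdiv_lt_0_compat; [|lra].
  apply Rmult_lt_0_compat; [apply Rdiv_lt_0_compat|]; lra. }
exists (Rmin (e / K) (r - Cmod z)); split.
{ apply Rmin_pos; [apply Rdiv_lt_0_compat|]; lra. }
intros w Hw.
assert (Hw1 := Rlt_le_trans _ _ _ Hw (Rmin_l _ _)).
assert (Hw2 := Rlt_le_trans _ _ _ Hw (Rmin_r _ _)).
assert (Wr : Cmod w <= r) by (assert (J := Cmod_minus_ge w z); lra).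
assert (Dw : unit_disk w) by (unfold unit_disk; lra).
assert (Sw := proj1 (pseries_Cseries _ _ _) (Ha w Dw)).
assert (Sz := proj1 (pseries_Cseries _ _ _) (Ha z Hz)).
(* Dropping the constant term aligns a(n+1) (w^(n+1) - z^(n+1)) with the n-th term of the derived
   series. The name [S] now hides the successor, hence [Datatypes.S] below. *)
assert (S := Cseries_minus _ _ _ _ (Cseries_tail _ _ (Cseries_minus _ _ _ _ Sw Sz))
               (Cseries_scal (w - z) _ _ Hl)).
set (h := Cmod (w - z)) in *.
assert (h0 : 0 <= h) by apply Cmod_ge_0.
assert (Main : Cmod (f w - f z - l * (w - z)) <= K * h ^ 2).
{ apply Rle_trans with (B / s / r * h ^ 2 * T).
  - replace (f w - f z - l * (w - z))%C
      with (f w - f z - (a 0%nat * w ^ 0 - a 0%nat * z ^ 0) - (w - z) * l)%C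
      by (simpl; ring).
    apply Cseries_le with (2 := S) (3 := is_series_scal_l (V := R_NormedModule)
                                     (B / s / r * h ^ 2) _ _ HT).
    intros n.
    change (scal (B / s / r * h ^ 2) (INR (Datatypes.S n) * INR (Datatypes.S (Datatypes.S n)) * q ^ n))
      with (B / s / r * h ^ 2 * (INR (Datatypes.S n) * INR (Datatypes.S (Datatypes.S n)) * q ^ n)).
    replace (a (Datatypes.S n) * w ^ Datatypes.S n - a (Datatypes.S n) * z ^ Datatypes.S n
               - (w - z) * (derivative_coef a n * z ^ n))%C
      with (a (Datatypes.S n) * (w ^ Datatypes.S n - z ^ Datatypes.S n
              - RtoC (INR (Datatypes.S n)) * z ^ n * (w - z)))%C
      by (unfold derivative_coef; ring).
    assert (L := Cpow_linear_remainder z w r n (Rlt_le _ _ (proj1 Hr)) Wr).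
    fold h in L; rewrite Cmod_mult.
    set (E := Cmod (_ - _ - _)) in L |- *.
    set (m := INR (Datatypes.S n) * INR (Datatypes.S (Datatypes.S n))) in *.
    apply Rle_trans with (B / s ^ Datatypes.S n * (m * r ^ n * h ^ 2 / r)).
    + apply Rmult_le_compat; [apply Cmod_ge_0|apply Cmod_ge_0|apply HB|].
      apply Rmult_le_reg_r with r; [exact r0|].
      unfold Rdiv; rewrite (Rmult_assoc _ (/ r)), Rinv_l; lra.
    + right; replace (B / s ^ Datatypes.S n * (m * r ^ n * h ^ 2 / r))
        with (B / s ^ Datatypes.S n * r ^ n * (m * h ^ 2 / r)) by (unfold Rdiv; ring).
      rewrite Eq; field; lra.
  - unfold K; replace (B / s * (Rabs T + 1) / r * h ^ 2)
      with (B / s / r * h ^ 2 * (Rabs T + 1)) by (field; lra).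
    assert (J := Rle_abs T).
    apply Rmult_le_compat_l; [|lra].
    apply Rmult_le_pos; [|apply pow2_ge_0].
    apply Rdiv_le_0_compat; [apply Rdiv_le_0_compat|]; lra. }
apply Rle_trans with (1 := Main).
assert (h * K <= e).
{ left; apply Rmult_lt_reg_r with (/ K); [apply Rinv_0_lt_compat, K0|].
  rewrite Rmult_assoc, Rinv_r by lra; lra. }
nra.
Qed.

(** The derivative comes with its own series, so the lemma can be iterated to reach higher
    derivatives. *)
Lemma taylor_derivative (f : C -> C) (a : nat -> C) :
  taylor_coefficients f a ->
  exists f1, taylor_coefficients f1 (derivative_coef a) /\ forall z, unit_disk z -> Cderiv f z (f1 z).
Proof.
intros Ha.
assert (U : forall z, unit_disk z -> Cseries (fun n => derivative_coef a n * z ^ n)%C (C_derive f z)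
              /\ Cderiv f z (C_derive f z)).
{ intros z Hz; destruct (taylor_derivative_exists f a z Ha Hz) as [l [H1 H2]].
  rewrite (Cderiv_C_derive _ _ _ H2); split; assumption. }
exists (C_derive f); split; intros z Hz.
- apply pseries_Cseries, U, Hz.
- apply U, Hz.
Qed.

Lemma taylor_at_0 (f : C -> C) (a : nat -> C) : taylor_coefficients f a -> f 0 = a 0%nat.
Proof.
intros Ha.
assert (D : unit_disk 0) by (unfold unit_disk; rewrite Cmod_0; lra).
apply (Cseries_unique (fun n => a n * 0 ^ n)%C); [apply pseries_Cseries, Ha, D|].
apply Cseries_cons.
(* At 0 every tail term vanishes; the zero series is obtained as 0 times the given convergent
   series. *)
replace (a 0%nat - a 0%nat * 0 ^ 0)%C with (0 * f 0)%C by (simpl; ring).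
apply Cseries_ext with (2 := Cseries_scal 0 _ _ (proj1 (pseries_Cseries _ _ _) (Ha 0%C D)) ).
intros n; simpl; ring.
Qed.

(** * The function psi_AP *)

Lemma Cmod_le_Re_Im (z : C) : Cmod z <= Rabs (Re z) + Rabs (Im z).
Proof.
replace z with (RtoC (Re z) + Ci * RtoC (Im z))%C at 1
  by (destruct z; apply injective_projections; simpl; ring).
apply Rle_trans with (1 := Cmod_triangle _ _).
rewrite Cmod_mult, Cmod_Ci, !Cmod_R; lra.
Qed.

Lemma im_le_Cmod (z : C) : Rabs (Im z) <= Cmod z.
Proof. apply Rle_trans with (2 := Rmax_Cmod z), Rmax_r. Qed.

(** The inequality exp y >= 1 + y at y = x gives the lower bound, and at y = -x it gives exp x (1 -
    x) <= 1, from which the upper bound follows. *)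
Lemma exp_quadratic_bound (x : R) : Rabs x <= / 2 -> 0 <= exp x - 1 - x <= 2 * x ^ 2.
Proof.
intros H; apply Rabs_le_between in H.
assert (A := exp_ineq1_le x); assert (B := exp_ineq1_le (- x)).
assert (P := exp_pos x).
assert (E : exp x * exp (- x) = 1)
  by (rewrite <- exp_plus, Rplus_opp_r; apply exp_0).
split; [lra|].
assert (exp x * (1 - x) <= 1) by nra.
apply Rmult_le_reg_r with (1 - x); [lra|].
assert (0 <= (1 - 2 * x) * x ^ 2) by (apply Rmult_le_pos; [lra|apply pow2_ge_0]).
nra.
Qed.

Lemma abs_sin_le (x : R) : Rabs (sin x) <= Rabs x.
Proof.
destruct (MVT_gen sin 0 x cos) as [c [_ E]].
- intros y _; apply is_derive_sin.
- intros y _; apply continuity_sin.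
- rewrite sin_0, !Rminus_0_r in E; rewrite E, Rabs_mult.
  assert (H := COS_bound c); assert (0 <= Rabs x) by apply Rabs_pos.
  assert (Rabs (cos c) <= 1) by (apply Rabs_le; lra).
  nra.
Qed.

Lemma cos_quadratic_bound (x : R) : 0 <= 1 - cos x <= x ^ 2 / 2.
Proof.
replace x with (2 * (x / 2)) at 1 2 by field; rewrite cos_2a_sin.
assert (H := abs_sin_le (x / 2)).
assert (K := pow2_ge_0 (sin (x / 2))).
apply Rsqr_le_abs_1 in H; unfold Rsqr in H; split; nra.
Qed.

Lemma sin_quadratic_bound (x : R) : Rabs x <= 1 -> Rabs (sin x - x) <= x ^ 2.
Proof.
intros Hx.
destruct (MVT_gen (fun y => sin y - y) 0 x (fun y => cos y - 1)) as [c [Hc E]].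
- intros y _; auto_derive; [trivial|ring].
- intros y _; apply derivable_continuous_pt; reg.
- rewrite sin_0, !Rminus_0_r in E; rewrite E, Rabs_mult.
  assert (H := cos_quadratic_bound c); assert (X := Rabs_pos x).
  assert (C : c ^ 2 <= x ^ 2).
  { rewrite <- !Rsqr_pow2; apply Rsqr_le_abs_1.
    unfold Rmin, Rmax in Hc; destruct (Rle_dec 0 x).
    - rewrite !Rabs_pos_eq; lra.
    - rewrite !Rabs_left1; lra. }
  rewrite (Rabs_left1 (cos c - 1)) by lra.
  assert (S : x ^ 2 = Rabs x * Rabs x) by (rewrite <- Rsqr_pow2, Rsqr_abs; reflexivity).
  rewrite S in *; nra.
Qed.

(** * The complex exponential *)

Lemma Cexp_0 : Cexp 0 = 1.
Proof.
unfold Cexp; simpl; rewrite exp_0, cos_0, sin_0; apply injective_projections; simpl; ring.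
Qed.

Lemma Cexp_plus (z w : C) : Cexp (z + w) = (Cexp z * Cexp w)%C.
Proof.
unfold Cexp; destruct z as [a b], w as [c d]; simpl.
rewrite exp_plus, cos_plus, sin_plus; apply injective_projections; simpl; ring.
Qed.

Lemma Cexp_neq_0 (z : C) : Cexp z <> 0%R.
Proof.
intros E; apply C1_nz; rewrite <- Cexp_0.
replace (RtoC 0) with (z + - z)%C at 1 by ring; rewrite Cexp_plus, E; ring.
Qed.

Lemma Cexp_quadratic_bound (h : C) :
  Cmod h <= / 2 -> Cmod (Cexp h - 1 - h) <= 8 * Cmod h ^ 2.
Proof.
intros H; apply Rle_trans with (1 := Cmod_le_Re_Im _).
assert (X := re_le_Cmod h); assert (Y := im_le_Cmod h).
assert (M2 := Cmod2_alt h).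
set (m := Cmod h) in *.
destruct h as [x y]; simpl Re in *; simpl Im in *; unfold Cexp; simpl.
assert (E := exp_quadratic_bound x ltac:(lra)).
assert (Cb := cos_quadratic_bound y).
assert (Sb := sin_quadratic_bound y ltac:(lra)).
assert (Ab := abs_sin_le y).
(* Both parts are split into products of the real second-order errors; they contribute at most 2 and
   3 times m^2, so the constant 8 is generous. *)
replace (exp x * cos y + - (1) + - x)
  with ((exp x - 1 - x) * cos y - (1 + x) * (1 - cos y)) by ring.
replace (exp x * sin y + - 0 + - y)
  with ((exp x - 1) * sin y + (sin y - y)) by ring.
assert (CB := COS_bound y).
apply Rabs_le_between in X as X'.
assert (x2 := pow2_ge_0 x); assert (y2 := pow2_ge_0 y).
assert (A1 : Rabs ((exp x - 1 - x) * cos y - (1 + x) * (1 - cos y)) <= 2 * m ^ 2).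
{ apply Rabs_le; nra. }
assert (A2 : Rabs ((exp x - 1) * sin y + (sin y - y)) <= 3 * m ^ 2).
{ apply Rle_trans with (1 := Rabs_triang _ _); rewrite Rabs_mult.
  assert (Ex : Rabs (exp x - 1) <= 2 * m).
  { apply Rabs_le; nra. }
  assert (Rabs (exp x - 1) * Rabs (sin y) <= 2 * m * m).
  { apply Rmult_le_compat; try apply Rabs_pos; lra. }
  nra. }
simpl in A1, A2 |- *; lra.
Qed.

Lemma Cderiv_Cexp (z : C) : Cderiv Cexp z (Cexp z).
Proof.
apply Cderiv_iff_eps; intros e He.
assert (P : 0 < Cmod (Cexp z)) by (apply Cmod_gt_0, Cexp_neq_0).
set (m := Cmod (Cexp z)) in *.
exists (Rmin (/ 2) (e / (8 * m))); split.
{ apply Rmin_pos; [lra|apply Rdiv_lt_0_compat; lra]. }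
intros w Hw.
assert (H1 := Rlt_le_trans _ _ _ Hw (Rmin_l _ _)).
assert (H2 := Rlt_le_trans _ _ _ Hw (Rmin_r _ _)).
set (h := (w - z)%C) in *.
replace w with (z + h)%C by (unfold h; ring); rewrite Cexp_plus.
replace (Cexp z * Cexp h - Cexp z - Cexp z * h)%C
  with (Cexp z * (Cexp h - 1 - h))%C by ring.
rewrite Cmod_mult; fold m.
assert (B := Cexp_quadratic_bound h (Rlt_le _ _ H1)).
assert (h0 := Cmod_ge_0 h).
apply Rle_trans with (m * (8 * Cmod h ^ 2)); [apply Rmult_le_compat_l; lra|].
assert (K : Cmod h * (8 * m) <= e).
{ left; apply Rmult_lt_reg_r with (/ (8 * m)); [apply Rinv_0_lt_compat; lra|].
  rewrite Rmult_assoc, Rinv_r by lra; unfold Rdiv in H2; lra. }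
nra.
Qed.

(** * The principal square root *)

Lemma Csqrt_Re_pos (v : C) : 0 < Re v -> 0 < Re (Csqrt v).
Proof.
intros H; unfold Csqrt; simpl; apply sqrt_lt_R0.
assert (0 <= Cmod v) by apply Cmod_ge_0; unfold Re in *; lra.
Qed.

Lemma Csqrt_sum_Re (v w : C) : Re (Csqrt v) <= Re (Csqrt w + Csqrt v).
Proof. assert (H := Csqrt_Re_ge0 w); simpl in *; unfold Re in *; lra. Qed.

Lemma Re_pos_neq_0 (z : C) : 0 < Re z -> z <> 0%R.
Proof. intros H E; rewrite E in H; simpl in H; lra. Qed.

Lemma Csqrt_diff (v w : C) :
  ((Csqrt w - Csqrt v) * (Csqrt w + Csqrt v))%C = (w - v)%C.
Proof.
transitivity (Csqrt w * Csqrt w - Csqrt v * Csqrt v)%C; [ring|].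
now rewrite !Csqrt_sqr.
Qed.

Lemma Ccont_Csqrt (v : C) : 0 < Re v -> Ccont Csqrt v.
Proof.
intros Hv e He; assert (P := Csqrt_Re_pos v Hv); set (m := Re (Csqrt v)) in *.
exists (e * m); split; [nra|]; intros w Hw.
rewrite <- Csqrt_diff, Cmod_mult in Hw.
assert (A := Csqrt_sum_Re v w); fold m in A.
assert (B := re_le_Cmod (Csqrt w + Csqrt v)); apply Rabs_le_between in B.
assert (D := Cmod_ge_0 (Csqrt w - Csqrt v)).
apply Rmult_lt_reg_r with m; [exact P|].
apply Rle_lt_trans with (2 := Hw), Rmult_le_compat_l; lra.
Qed.

(** By [Csqrt_diff] the slope is 1 / (sqrt w + sqrt v). Its denominator has real part at least Re
    (sqrt v) > 0 for every w, so the identity holds globally, even across the branch cut. *)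
Lemma Cderiv_Csqrt (v : C) : 0 < Re v -> Cderiv Csqrt v (/ (2 * Csqrt v))%C.
Proof.
intros Hv; assert (P := Csqrt_Re_pos v Hv).
assert (N : forall w, (Csqrt w + Csqrt v)%C <> 0%R).
{ intros w; apply Re_pos_neq_0; assert (A := Csqrt_sum_Re v w); lra. }
exists (fun w => / (Csqrt w + Csqrt v))%C; split; [|split].
- apply (Ccont_comp (fun w => Csqrt w + Csqrt v)%C Cinv); [|apply Ccont_Cinv, N].
  apply Ccont_plus; [apply Ccont_Csqrt, Hv|apply Ccont_const].
- f_equal; ring.
- intros w; rewrite <- (Csqrt_diff v w); field; apply N.
Qed.

Lemma disk_one_plus_Re (z : C) : unit_disk z -> 0 < Re (1 + z).
Proof.
intros H; unfold unit_disk in H; assert (A := re_le_Cmod z); apply Rabs_le_between in A.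
simpl; unfold Re in A; lra.
Qed.

Lemma Cderiv_Csqrt_1p (z : C) :
  unit_disk z -> Cderiv (fun w => Csqrt (1 + w))%C z (/ (2 * Csqrt (1 + z)))%C.
Proof.
intros Hz; apply Cderiv_eq with (/ (2 * Csqrt (1 + z)) * (0 + 1))%C; [ring|].
apply (Cderiv_comp (fun w => 1 + w)%C Csqrt).
- apply Cderiv_plus; [apply Cderiv_const|apply Cderiv_id].
- apply Cderiv_Csqrt, disk_one_plus_Re, Hz.
Qed.

Lemma Csqrt_1p_neq_0 (z : C) : unit_disk z -> Csqrt (1 + z) <> 0%R.
Proof. intros Hz; apply Re_pos_neq_0, Csqrt_Re_pos, disk_one_plus_Re, Hz. Qed.

Lemma Csqrt_1 : Csqrt (1 + 0) = 1.
Proof.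
replace (1 + 0)%C with (RtoC 1) by ring; unfold Csqrt; rewrite Cmod_1; simpl.
destruct (Rlt_dec 0 0); [lra|].
replace ((1 + 1) / 2) with 1 by field; replace ((1 - 1) / 2) with 0 by field.
rewrite sqrt_0, sqrt_1; reflexivity.
Qed.

Definition psi_AP' (z : C) : C := (Cexp z * (3 + 2 * z) / (2 * Csqrt (1 + z)))%C.

Lemma two_C_neq_0 : RtoC 2 <> 0%R.
Proof. intro E; apply RtoC_inj in E; lra. Qed.

Lemma Cderiv_psi (z : C) : unit_disk z -> Cderiv psi_AP z (psi_AP' z).
Proof.
intros Hz; apply Cderiv_eq with (2 := Cderiv_mult _ _ _ _ _ (Cderiv_Cexp z) (Cderiv_Csqrt_1p z Hz)).
assert (N := Csqrt_1p_neq_0 z Hz); assert (S := Csqrt_sqr (1 + z)).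
unfold psi_AP'; cbv beta; set (s := Csqrt (1 + z)) in *.
replace (3 + 2 * z)%C with (2 * (s * s) + 1)%C by (rewrite S; ring).
field; exact N.
Qed.

Lemma psi_neq_0 (z : C) : unit_disk z -> psi_AP z <> 0%R.
Proof. intros Hz; apply Cmult_neq_0; [apply Cexp_neq_0|apply Csqrt_1p_neq_0, Hz]. Qed.

(** The only zero of 3 + 2 z is -3/2, outside the disk. This allows the relation for the Schwarz
    function to be solved for its derivative. *)
Lemma psi'_neq_0 (z : C) : unit_disk z -> psi_AP' z <> 0%R.
Proof.
intros Hz; assert (N := Csqrt_1p_neq_0 z Hz).
unfold psi_AP', Cdiv; apply Cmult_neq_0; [apply Cmult_neq_0; [apply Cexp_neq_0|]|].
- apply Re_pos_neq_0; assert (A := disk_one_plus_Re z Hz); simpl in *; unfold Re in *; lra.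
- intros E; assert (K : (2 * Csqrt (1 + z) * / (2 * Csqrt (1 + z)))%C = 1).
  { apply Cinv_r, Cmult_neq_0; [exact two_C_neq_0|exact N]. }
  rewrite E in K; apply C1_nz; rewrite <- K; ring.
Qed.

Lemma psi_0 : psi_AP 0 = 1.
Proof. unfold psi_AP; rewrite Cexp_0, Csqrt_1; ring. Qed.

Lemma psi'_0 : psi_AP' 0 = RtoC (3 / 2).
Proof.
unfold psi_AP'; rewrite Cexp_0, Csqrt_1, RtoC_div by lra; field; exact two_C_neq_0.
Qed.

Lemma Cderiv_psi' (z : C) : unit_disk z -> Cderiv psi_AP' z
  ((Cexp z * (5 + 2 * z) * (2 * Csqrt (1 + z)) - Cexp z * (3 + 2 * z) / Csqrt (1 + z))
    / (4 * (1 + z)))%C.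
Proof.
intros Hz; assert (N := Csqrt_1p_neq_0 z Hz); assert (S := Csqrt_sqr (1 + z)).
assert (Hn : Cderiv (fun w => Cexp w * (3 + 2 * w))%C z
               (Cexp z * (3 + 2 * z) + Cexp z * (0 + (0 * z + 2 * 1)))%C).
{ apply (Cderiv_mult Cexp (fun w => 3 + 2 * w)%C); [apply Cderiv_Cexp|].
  apply (Cderiv_plus (fun _ => RtoC 3) (fun w => 2 * w)%C); [apply Cderiv_const|].
  apply (Cderiv_mult (fun _ => RtoC 2) (fun w => w)); [apply Cderiv_const|apply Cderiv_id]. }
assert (Hd := Cderiv_mult _ _ _ _ _ (Cderiv_const 2 z) (Cderiv_Csqrt_1p z Hz)).
assert (M : (2 * Csqrt (1 + z))%C <> 0%R)
  by (apply Cmult_neq_0; [exact two_C_neq_0|exact N]).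
apply Cderiv_eq with (2 := Cderiv_div _ (fun w => 2 * Csqrt (1 + w))%C z _ _ M Hn Hd).
cbv beta; set (s := Csqrt (1 + z)) in *; rewrite <- S; field.
repeat split; try exact N; intro E; apply RtoC_inj in E; lra.
Qed.

(** The expansion psi(z) = 1 + (3/2) z + (7/8) z^2 + ... makes the second derivative at 0 equal to
    7/4. *)
Lemma Cderiv_psi'_0 : Cderiv psi_AP' 0 (RtoC (7 / 4)).
Proof.
apply Cderiv_eq with (2 := Cderiv_psi' 0 ltac:(unfold unit_disk; rewrite Cmod_0; lra)).
rewrite Cexp_0, Csqrt_1, RtoC_div by lra; field.
Qed.

(** * Complex-valued functions of a real variable and their circle means *)

Lemma Ccont_Re (z : C) : Ccont (fun w => RtoC (Re w)) z.
Proof.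
intros e He; exists e; split; [exact He|]; intros w Hw.
rewrite <- RtoC_minus, Cmod_R; apply Rle_lt_trans with (2 := Hw).
replace (Re w - Re z) with (Re (w - z)) by (destruct w, z; reflexivity).
apply re_le_Cmod.
Qed.

Lemma Ccont_Im (z : C) : Ccont (fun w => RtoC (Im w)) z.
Proof.
intros e He; exists e; split; [exact He|]; intros w Hw.
rewrite <- RtoC_minus, Cmod_R; apply Rle_lt_trans with (2 := Hw).
replace (Im w - Im z) with (Im (w - z)) by (destruct w, z; reflexivity).
apply im_le_Cmod.
Qed.

(* Continuity of [g : R -> C] at [t], seen as a function of the real part so
   that the rules for [Ccont] apply. *)
Definition Rcont_at (g : R -> C) (t : R) : Prop := Ccont (fun z => g (Re z)) (RtoC t).

Lemma Rcont_at_const (c : C) (t : R) : Rcont_at (fun _ => c) t.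
Proof. apply Ccont_const. Qed.

Lemma Rcont_at_mult (g h : R -> C) (t : R) : Rcont_at g t -> Rcont_at h t -> Rcont_at (fun s => g s * h s)%C t.
Proof. apply Ccont_mult. Qed.

Lemma Rcont_at_plus (g h : R -> C) (t : R) : Rcont_at g t -> Rcont_at h t -> Rcont_at (fun s => g s + h s)%C t.
Proof. apply Ccont_plus. Qed.

Lemma Rcont_at_comp (g : R -> C) (f : C -> C) (t : R) :
  Rcont_at g t -> Ccont f (g t) -> Rcont_at (fun s => f (g s)) t.
Proof. apply (Ccont_comp (fun z => g (Re z)) f). Qed.

Lemma Rcont_at_eps (g : R -> C) (t : R) : Rcont_at g t <->
  forall eps, 0 < eps -> exists d, 0 < d /\
    forall s, Rabs (s - t) < d -> Cmod (g s - g t) < eps.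
Proof.
split; intros H e He; destruct (H e He) as [d [P K]]; exists d; split; try exact P.
- intros s Hs; apply (K (RtoC s)); rewrite <- RtoC_minus, Cmod_R; exact Hs.
- intros w Hw; apply K; simpl.
  apply Rle_lt_trans with (2 := Hw).
  replace (Re w - t) with (Re (w - t)) by (destruct w; reflexivity).
  apply re_le_Cmod.
Qed.

Lemma Rcont_at_continuous (g : R -> C) (p : C -> R) (t : R) :
  (forall a b, Rabs (p a - p b) <= Cmod (a - b)) -> Rcont_at g t ->
  continuous (fun s => p (g s)) t.
Proof.
rewrite Rcont_at_eps; intros Hp H; apply filterlim_locally; intros [e He].
destruct (H e He) as [d [P K]]; exists (mkposreal d P); intros s Hs.
apply Rle_lt_trans with (1 := Hp _ _); apply K, Hs.
Qed.

Lemma Re_lipschitz (a b : C) : Rabs (Re a - Re b) <= Cmod (a - b).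
Proof. exact (re_le_Cmod (a - b)). Qed.

Lemma Cmod_lipschitz (a b : C) : Rabs (Cmod a - Cmod b) <= Cmod (a - b).
Proof.
assert (H := Cmod_minus_ge a b); assert (K := Cmod_minus_ge b a).
rewrite Cmod_minus_sym in K; apply Rabs_le; lra.
Qed.

Lemma Rcont_at_ex_RInt (g : R -> C) (p : C -> R) (a b : R) :
  (forall x y, Rabs (p x - p y) <= Cmod (x - y)) -> (forall t, Rcont_at g t) ->
  ex_RInt (fun t => p (g t)) a b.
Proof.
intros Hp H; apply (ex_RInt_continuous (V := R_CompleteNormedModule)).
intros t _; apply (Rcont_at_continuous g p t Hp (H t)).
Qed.

Definition Rderiv (g : R -> C) (t : R) (l : C) : Prop :=
  exists phi, Rcont_at phi t /\ phi t = l /\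
    forall s, (g s - g t)%C = (phi s * RtoC (s - t))%C.

Lemma Rderiv_eq (g : R -> C) (t : R) (l l' : C) : l = l' -> Rderiv g t l -> Rderiv g t l'.
Proof. now intros ->. Qed.

Lemma Rderiv_affine (a b : C) (t : R) : Rderiv (fun s => a + RtoC s * b)%C t b.
Proof.
exists (fun _ => b); split; [apply Rcont_at_const|split; [reflexivity|]].
intros s; rewrite RtoC_minus; ring.
Qed.

Lemma Rderiv_continuous (g : R -> C) (t : R) (l : C) : Rderiv g t l -> Rcont_at g t.
Proof.
intros [phi [Hc [_ Hf]]].
apply (Ccont_ext_loc (fun w => g t + phi (Re w) * (RtoC (Re w) - RtoC t))%C _ _ 1); [lra| |].
- intros w _; rewrite <- RtoC_minus, <- Hf; ring.
- apply Ccont_plus; [apply Ccont_const|].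
  apply Ccont_mult; [exact Hc|].
  apply Ccont_plus; [apply Ccont_Re|apply Ccont_const].
Qed.

Lemma Rderiv_comp (g : R -> C) (f : C -> C) (t : R) (l m : C) :
  Rderiv g t l -> Cderiv f (g t) m -> Rderiv (fun s => f (g s)) t (m * l)%C.
Proof.
intros Hg Hf; assert (Cg := Rderiv_continuous _ _ _ Hg).
destruct Hg as [p [Cp [Vp Ep]]]; destruct Hf as [q [Cq [Vq Eq]]].
exists (fun s => q (g s) * p s)%C; split; [|split].
- apply Rcont_at_mult; [apply Rcont_at_comp|]; assumption.
- now rewrite Vp, Vq.
- intros s; rewrite Eq, Ep; ring.
Qed.

Lemma Rderiv_mult_const (g : R -> C) (c : C) (t : R) (l : C) :
  Rderiv g t l -> Rderiv (fun s => g s * c)%C t (l * c)%C.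
Proof.
intros [p [Cp [Vp Ep]]]; exists (fun s => p s * c)%C; split; [|split].
- apply Rcont_at_mult; [exact Cp|apply Rcont_at_const].
- now rewrite Vp.
- intros s; replace (g s * c - g t * c)%C with ((g s - g t) * c)%C by ring.
  rewrite Ep; ring.
Qed.

Lemma Rderiv_is_derive (g : R -> C) (t : R) (l : C) :
  Rderiv g t l -> is_derive (fun s => Re (g s)) t (Re l).
Proof.
intros [p [Cp [Vp Ep]]]; apply is_derive_Reals; intros e He.
destruct (proj1 (Rcont_at_eps _ _) Cp e He) as [d [P K]].
exists (mkposreal d P); intros h Hh Hd; simpl in Hd.
assert (Eh := Ep (t + h)); replace (t + h - t) with h in Eh by ring.
replace ((Re (g (t + h)) - Re (g t)) / h - Re l) with (Re (p (t + h) - p t)).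
- apply Rle_lt_trans with (1 := re_le_Cmod _); apply K.
  replace (t + h - t) with h by ring; exact Hd.
- rewrite <- Vp.
  replace (Re (g (t + h)) - Re (g t)) with (Re (g (t + h) - g t)) by reflexivity.
  rewrite Eh; simpl; unfold Re; field; exact Hh.
Qed.

(** * The unit circle and means over it *)

Definition expi (t : R) : C := Cexp (RtoC t * Ci).

Lemma expi_pair (t : R) : expi t = (cos t, sin t).
Proof.
unfold expi, Cexp; simpl; replace (t * 0 - 0 * 1) with 0 by ring.
replace (t * 1 + 0 * 0) with t by ring; rewrite exp_0, !Rmult_1_l; reflexivity.
Qed.

Lemma expi_mod (t : R) : Cmod (expi t) = 1.
Proof.
rewrite expi_pair; unfold Cmod; simpl.
assert (H := sin2_cos2 t); unfold Rsqr in H.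
replace (cos t * (cos t * 1) + sin t * (sin t * 1)) with 1 by lra; apply sqrt_1.
Qed.

Lemma expi_neq_0 (t : R) : expi t <> 0%R.
Proof. apply Cexp_neq_0. Qed.

Lemma expi_2PI : expi (2 * PI) = expi 0.
Proof. rewrite !expi_pair, cos_2PI, sin_2PI, cos_0, sin_0; reflexivity. Qed.

Lemma expi_conj (t : R) : Cconj (expi t) = (/ expi t)%C.
Proof.
rewrite expi_pair; unfold Cconj, Cinv; simpl.
assert (H := sin2_cos2 t); unfold Rsqr in H.
replace (cos t * (cos t * 1) + sin t * (sin t * 1)) with 1 by lra.
apply injective_projections; simpl; field.
Qed.

Lemma Rderiv_expi (t : R) : Rderiv expi t (expi t * Ci)%C.
Proof.
apply (Rderiv_comp (fun s => RtoC s * Ci)%C Cexp).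
- apply Rderiv_eq with (l := Ci); [reflexivity|].
  destruct (Rderiv_affine 0 Ci t) as [p [Cp [Vp Ep]]]; exists p; repeat split; try assumption.
  intros s; rewrite <- Ep; ring.
- apply Cderiv_Cexp.
Qed.

Lemma Rcont_at_expi (t : R) : Rcont_at expi t.
Proof. apply Rderiv_continuous with (1 := Rderiv_expi t). Qed.

Definition re_mean (g : R -> C) : R := RInt (fun t => Re (g t)) 0 (2 * PI) / (2 * PI).

Definition Rcont (g : R -> C) : Prop := forall t, Rcont_at g t.

Lemma re_mean_ext (g h : R -> C) : (forall t, g t = h t) -> re_mean g = re_mean h.
Proof.
intros H; unfold re_mean; f_equal; apply RInt_ext; intros t _; now rewrite H.
Qed.

Lemma re_mean_plus (g h : R -> C) :
  Rcont g -> Rcont h -> re_mean (fun t => g t + h t)%C = re_mean g + re_mean h.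
Proof.
intros Hg Hh; unfold re_mean, Rdiv; rewrite <- Rmult_plus_distr_r; f_equal.
apply (RInt_plus (V := R_CompleteNormedModule) (fun t => Re (g t)) (fun t => Re (h t)));
  apply Rcont_at_ex_RInt; try assumption; apply Re_lipschitz.
Qed.

Lemma re_mean_scal (k : R) (g : R -> C) :
  Rcont g -> re_mean (fun t => RtoC k * g t)%C = k * re_mean g.
Proof.
intros Hg; unfold re_mean, Rdiv; rewrite <- Rmult_assoc; f_equal.
rewrite <- (RInt_scal (V := R_CompleteNormedModule) (fun t => Re (g t))).
- apply RInt_ext; intros t _; simpl; unfold scal; simpl; unfold mult, Re; simpl; ring.
- apply Rcont_at_ex_RInt; [apply Re_lipschitz|exact Hg].
Qed.

Lemma PI2_pos : 0 < 2 * PI.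
Proof. assert (H := PI_RGT_0); lra. Qed.

Lemma re_mean_const (c : C) : re_mean (fun _ => c) = Re c.
Proof.
unfold re_mean; rewrite RInt_const; unfold scal; simpl; unfold mult; simpl.
field; apply PI_neq0.
Qed.

Lemma re_mean_le (g h : R -> C) :
  Rcont g -> Rcont h -> (forall t, Re (g t) <= Re (h t)) -> re_mean g <= re_mean h.
Proof.
intros Hg Hh H; assert (P := PI2_pos); unfold re_mean, Rdiv.
apply Rmult_le_compat_r; [left; apply Rinv_0_lt_compat, P|].
apply RInt_le; [lra| | |intros t _; apply H];
  apply Rcont_at_ex_RInt; try assumption; apply Re_lipschitz.
Qed.

(** The fundamental theorem of calculus for a primitive with equal end values. *)
Lemma re_mean_derivative (F g : R -> C) :
  (forall t, Rderiv F t (g t)) -> Rcont g -> F (2 * PI) = F 0 -> re_mean g = 0.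
Proof.
intros HF Hg HP; unfold re_mean.
assert (I := is_RInt_derive (V := R_CompleteNormedModule)
  (fun t => Re (F t)) (fun t => Re (g t)) 0 (2 * PI)
  (fun t _ => Rderiv_is_derive _ _ _ (HF t))
  (fun t _ => Rcont_at_continuous g Re t Re_lipschitz (Hg t))).
rewrite (is_RInt_unique _ _ _ _ I), HP.
unfold minus, plus, opp; simpl; unfold Rdiv; ring.
Qed.

Lemma Cpow_expi (t : R) (n : nat) : (expi t ^ n)%C = Cexp (RtoC t * (RtoC (INR n) * Ci)).
Proof.
induction n as [|n IH].
- simpl; rewrite <- Cexp_0; f_equal; ring.
- rewrite S_INR, RtoC_plus; simpl Cpow; rewrite IH; unfold expi; rewrite <- Cexp_plus.
  f_equal; ring.
Qed.

Lemma Rderiv_Cexp_linear (b : C) (t : R) : Rderiv (fun s => Cexp (RtoC s * b)) t (Cexp (RtoC t * b) * b)%C.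
Proof.
apply (Rderiv_comp (fun s => RtoC s * b)%C Cexp); [|apply Cderiv_Cexp].
destruct (Rderiv_affine 0 b t) as [p [Cp [Vp Ep]]]; exists p; repeat split; try assumption.
intros s; rewrite <- Ep; ring.
Qed.

Lemma Rcont_at_pow (g : R -> C) (t : R) (n : nat) : Rcont_at g t -> Rcont_at (fun s => g s ^ n)%C t.
Proof.
intros H; induction n as [|n IH]; [exact (Rcont_at_const 1 t)|].
exact (Rcont_at_mult _ _ _ H IH).
Qed.

Lemma Rcont_at_inv (g : R -> C) (t : R) : Rcont_at g t -> g t <> 0%R -> Rcont_at (fun s => / g s)%C t.
Proof. intros H N; apply (Rcont_at_comp g Cinv); [exact H|apply Ccont_Cinv, N]. Qed.

Lemma re_mean_expi_pow (c : C) (n : nat) : (0 < n)%nat -> re_mean (fun t => c * expi t ^ n)%C = 0.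
Proof.
intros Hn.
assert (N : (RtoC (INR n) * Ci)%C <> 0%R).
{ apply Cmult_neq_0; [|exact Ci_nz].
  intro K; apply RtoC_inj in K; apply lt_0_INR in Hn; lra. }
apply re_mean_derivative with
  (F := fun t => (Cexp (RtoC t * (RtoC (INR n) * Ci)) * (c / (RtoC (INR n) * Ci)))%C).
- intros t; apply Rderiv_eq with (2 := Rderiv_mult_const _ _ _ _ (Rderiv_Cexp_linear _ t)).
  rewrite Cpow_expi; field.
  split; [exact Ci_nz|intro K; apply N; rewrite K; ring].
- intros t; apply Rcont_at_mult; [apply Rcont_at_const|apply Rcont_at_pow, Rcont_at_expi].
- now rewrite <- !Cpow_expi, expi_2PI.
Qed.

(** Conjugation turns negative powers of [expi t] into positive ones and keeps the real part. *)
Lemma re_mean_expi_pow_neg (c : C) (n : nat) :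
  (0 < n)%nat -> re_mean (fun t => c * (/ expi t) ^ n)%C = 0.
Proof.
intros Hn; rewrite <- (re_mean_expi_pow (Cconj c) n Hn); unfold re_mean; f_equal.
apply RInt_ext; intros t _.
rewrite <- (re_conj (Cconj c * expi t ^ n)), Cmult_conj, Cconj_conj, Cpow_conj, expi_conj.
reflexivity.
Qed.

(** * Cauchy's theorem *)

Section Homotopy.
Variables (f f' : C -> C) (z k : C) (r : R) (K : R -> C).
Hypothesis Hf : forall w, unit_disk w -> Cderiv f w (f' w).
Hypothesis Cf' : forall w, unit_disk w -> Ccont f' w.
Hypothesis Hr : 0 < r < 1.
Hypothesis Hz : Cmod z <= r.
Hypothesis HK : Rcont K.
(** This says K = k w / (w - z), where w = r e^(it), without a division. The values k = 1 and k = -i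
    will yield the real and the imaginary part of Cauchy's formula. *)
Hypothesis EK : forall t, (K t * (RtoC r * expi t - z))%C = (k * (RtoC r * expi t))%C.

Let zeta (u v : R) : C := (z + RtoC u * (RtoC r * expi v - z))%C.
(** A margin around [0, 1]: with it the integral over the contracted circle is differentiable at the
    end points u = 0 and u = 1 as well. *)
Let d : R := (1 - r) / 2.

(** For u within the margin, |1 - u| + |u| <= 2 - r, and r (2 - r) = 1 - (1 - r)^2 < 1. *)
Lemma zeta_disk (u v : R) : - d < u < 1 + d -> unit_disk (zeta u v).
Proof.
intros Hu; unfold unit_disk, zeta, d in *.
replace (z + RtoC u * (RtoC r * expi v - z))%C
  with (RtoC (1 - u) * z + RtoC u * (RtoC r * expi v))%C
  by (rewrite RtoC_minus; ring).
apply Rle_lt_trans with (1 := Cmod_triangle _ _).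
rewrite !Cmod_mult, !Cmod_R, expi_mod, (Rabs_pos_eq r) by lra.
apply Rle_lt_trans with (Rabs (1 - u) * r + Rabs u * r).
- apply Rplus_le_compat; [|lra].
  apply Rmult_le_compat_l; [apply Rabs_pos|exact Hz].
- assert (Rabs (1 - u) + Rabs u <= 2 - r)
    by (unfold Rabs; destruct (Rcase_abs (1 - u)), (Rcase_abs u); lra).
  nra.
Qed.

Lemma Rcont_at_zeta (u : R) : Rcont (zeta u).
Proof.
intros t; unfold zeta.
apply Rcont_at_plus; [apply Rcont_at_const|]; apply Rcont_at_mult; [apply Rcont_at_const|].
apply Rcont_at_plus; [apply Rcont_at_mult; [apply Rcont_at_const|apply Rcont_at_expi]|apply Rcont_at_const].
Qed.

Lemma zeta_integrand_derive (u v : R) : - d < u < 1 + d ->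
  is_derive (fun x => Re (f (zeta x v) * K v)) u (Re (f' (zeta u v) * (k * (RtoC r * expi v)))).
Proof.
intros Hu; apply (Rderiv_is_derive (fun x => f (zeta x v) * K v)%C).
apply Rderiv_eq with (2 := Rderiv_mult_const _ (K v) _ _
  (Rderiv_comp _ f _ _ _ (Rderiv_affine z (RtoC r * expi v - z) u) (Hf _ (zeta_disk u v Hu)))).
rewrite <- EK; unfold zeta; ring.
Qed.

(** Since the v-derivative of zeta is i u w, the integrand is the v-derivative of f(zeta) k / (i u),
    a periodic function. Dividing by u excludes u = 0. *)
Lemma re_mean_homotopy_deriv_0 (u : R) : 0 < u < 1 ->
  RInt (fun v => Re (f' (zeta u v) * (k * (RtoC r * expi v)))) 0 (2 * PI) = 0.
Proof.
intros Hu.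
assert (Hd : - d < u < 1 + d) by (unfold d; lra).
assert (U0 : (RtoC u * Ci)%C <> 0%R).
{ apply Cmult_neq_0; [|exact Ci_nz]; intro K0; apply RtoC_inj in K0; lra. }
assert (M : re_mean (fun v => f' (zeta u v) * (k * (RtoC r * expi v)))%C = 0).
{ apply re_mean_derivative with (F := fun v => (f (zeta u v) * (k / (RtoC u * Ci)))%C).
  - intros t.
    assert (Z : Rderiv (zeta u) t (RtoC u * RtoC r * (expi t * Ci))%C).
    { destruct (Rderiv_expi t) as [p [Cp [Vp Ep]]].
      exists (fun s => RtoC u * RtoC r * p s)%C; split; [|split].
      - apply Rcont_at_mult; [apply Rcont_at_const|exact Cp].
      - now rewrite Vp.
      - intros s; transitivity (RtoC u * RtoC r * (expi s - expi t))%C; [unfold zeta; ring|].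
        rewrite Ep; ring. }
    apply Rderiv_eq with (2 := Rderiv_mult_const _ (k / (RtoC u * Ci)) _ _
      (Rderiv_comp _ f _ _ _ Z (Hf _ (zeta_disk u t Hd)))).
    field; split; [exact Ci_nz|intro E0; apply U0; rewrite E0; ring].
  - intros t; apply Rcont_at_mult.
    + apply Rcont_at_comp; [apply Rcont_at_zeta|apply Cf', zeta_disk, Hd].
    + apply Rcont_at_mult; [apply Rcont_at_const|apply Rcont_at_mult; [apply Rcont_at_const|apply Rcont_at_expi]].
  - unfold zeta; now rewrite expi_2PI. }
assert (P := PI2_pos); unfold re_mean in M.
apply Rmult_integral in M; destruct M as [M|M]; [exact M|].
assert (Q := Rinv_0_lt_compat _ P); lra.
Qed.

Lemma zeta_derivative_continuity (u v : R) : - d < u < 1 + d ->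
  continuity_2d_pt (fun x y => Re (f' (zeta x y) * (k * (RtoC r * expi y)))) u v.
Proof.
intros Hu [e He].
assert (HE : Ccont (fun w => expi (Im w)) (u, v)).
{ unfold expi; apply (Ccont_comp (fun w => RtoC (Im w) * Ci)%C Cexp).
  - apply Ccont_mult; [apply Ccont_Im|apply Ccont_const].
  - apply Cderiv_Ccont with (1 := Cderiv_Cexp _). }
assert (Cc : Ccont (fun w => f' (zeta (Re w) (Im w)) * (k * (RtoC r * expi (Im w))))%C (u, v)).
{ apply Ccont_mult.
  - apply (Ccont_comp (fun w => zeta (Re w) (Im w)) f').
    + apply Ccont_plus; [apply Ccont_const|]; apply Ccont_mult; [apply Ccont_Re|].
      apply Ccont_plus; [|apply Ccont_const].
      apply Ccont_mult; [apply Ccont_const|exact HE].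
    + apply Cf', zeta_disk, Hu.
  - apply Ccont_mult; [apply Ccont_const|].
    apply Ccont_mult; [apply Ccont_const|exact HE]. }
destruct (Cc e He) as [c [c0 H]].
exists (mkposreal (c / 2) ltac:(lra)); intros x y Hx Hy; simpl in Hx, Hy.
apply Rle_lt_trans with (1 := Re_lipschitz _ _); apply (H (x, y)).
apply Rle_lt_trans with (1 := Cmod_le_Re_Im _); simpl; unfold Rminus in *; lra.
Qed.

Lemma re_mean_homotopy :
  re_mean (fun t => f (RtoC r * expi t) * K t)%C = re_mean (fun t => f z * K t)%C.
Proof.
set (G := fun u => RInt (fun v => Re (f (zeta u v) * K v)) 0 (2 * PI)).
assert (d0 : 0 < d) by (unfold d; lra).
assert (D : forall u, - d < u < 1 + d -> is_derive G u
              (RInt (fun v => Re (f' (zeta u v) * (k * (RtoC r * expi v)))) 0 (2 * PI))).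
{ intros u Hu.
  assert (L : locally u (fun x => - d < x < 1 + d)).
  { exists (mkposreal (Rmin (u + d) (1 + d - u)) ltac:(apply Rmin_pos; lra)).
    intros x Hx; change (Rabs (x - u) < Rmin (u + d) (1 + d - u)) in Hx.
    assert (A := Rlt_le_trans _ _ _ Hx (Rmin_l _ _)).
    assert (B := Rlt_le_trans _ _ _ Hx (Rmin_r _ _)).
    apply Rabs_lt_between in A; apply Rabs_lt_between in B; lra. }
  replace (RInt (fun v => Re (f' (zeta u v) * (k * (RtoC r * expi v)))) 0 (2 * PI))
    with (RInt (fun v => Derive (fun x => Re (f (zeta x v) * K v)) u) 0 (2 * PI)).
  2:{ apply RInt_ext; intros v _; apply is_derive_unique, zeta_integrand_derive, Hu. }
  (* Differentiation under the integral sign. Its hypotheses are required for all parameters near u,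
     which L provides. *)
  apply (is_derive_RInt_param (fun x v => Re (f (zeta x v) * K v))).
  - apply filter_imp with (2 := L); intros x Hx v _.
    eexists; apply zeta_integrand_derive, Hx.
  - intros v _.
    apply continuity_2d_pt_ext_loc with
      (2 := zeta_derivative_continuity u v Hu).
    destruct L as [e He]; exists e; intros x y Hx _.
    symmetry; apply is_derive_unique, zeta_integrand_derive, He, Hx.
  - apply filter_imp with (2 := L); intros x Hx.
    apply (Rcont_at_ex_RInt (fun v => f (zeta x v) * K v)%C Re); [apply Re_lipschitz|].
    intros t; apply Rcont_at_mult; [|apply HK].
    apply Rcont_at_comp; [apply Rcont_at_zeta|].
    apply Cderiv_Ccont with (1 := Hf _ (zeta_disk x t Hx)). }
(* A zero derivative on the open interval suffices for the mean value theorem; at the end points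
   only continuity of G is used. The value u = 1 is the circle, u = 0 the point z. *)
destruct (MVT_gen G 0 1 (fun _ => 0)) as [c [_ Hc]].
- rewrite Rmin_left, Rmax_right by lra; intros u Hu.
  rewrite <- (re_mean_homotopy_deriv_0 u Hu); apply D; lra.
- rewrite Rmin_left, Rmax_right by lra; intros u Hu.
  apply derivable_continuous_pt.
  eexists; apply is_derive_Reals, D; lra.
- assert (E1 : G 1 = G 0) by lra.
  unfold re_mean; f_equal; unfold G in E1.
  transitivity (RInt (fun v => Re (f (zeta 1 v) * K v)) 0 (2 * PI)).
  + apply RInt_ext; intros v _; unfold zeta; do 3 f_equal; ring.
  + rewrite E1; apply RInt_ext; intros v _; unfold zeta; do 3 f_equal; ring.
Qed.

End Homotopy.

(** * Cauchy's formula and Taylor expansions *)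

(** The second component is the mean of Im g, because Re (-i g) = Im g. *)
Definition Cmean (g : R -> C) : C := (re_mean g, re_mean (fun t => - Ci * g t)%C).

Lemma Rcont_scal (c : C) (g : R -> C) : Rcont g -> Rcont (fun t => c * g t)%C.
Proof. intros H t; apply Rcont_at_mult; [apply Rcont_at_const|apply H]. Qed.

Lemma Rcont_mult (g h : R -> C) : Rcont g -> Rcont h -> Rcont (fun t => g t * h t)%C.
Proof. intros Hg Hh t; apply Rcont_at_mult; [apply Hg|apply Hh]. Qed.

Lemma Rcont_plus (g h : R -> C) : Rcont g -> Rcont h -> Rcont (fun t => g t + h t)%C.
Proof. intros Hg Hh t; apply Rcont_at_plus; [apply Hg|apply Hh]. Qed.

Lemma Rcont_const (c : C) : Rcont (fun _ => c).
Proof. intros t; apply Rcont_at_const. Qed.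

Lemma Cmean_ext (g h : R -> C) : (forall t, g t = h t) -> Cmean g = Cmean h.
Proof.
intros H; unfold Cmean; f_equal; apply re_mean_ext; intros t; now rewrite H.
Qed.

Lemma Cmean_plus (g h : R -> C) :
  Rcont g -> Rcont h -> Cmean (fun t => g t + h t)%C = (Cmean g + Cmean h)%C.
Proof.
intros Hg Hh; unfold Cmean; apply injective_projections; simpl.
- apply re_mean_plus; assumption.
- rewrite <- re_mean_plus by (apply Rcont_scal; assumption).
  apply re_mean_ext; intros t; ring.
Qed.

Lemma re_mean_cscal (c : C) (g : R -> C) : Rcont g ->
  re_mean (fun t => c * g t)%C = Re (c * Cmean g).
Proof.
intros Hg; destruct c as [a b].
transitivity (re_mean (fun t => RtoC a * g t + RtoC (- b) * (- Ci * g t))%C).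
- apply re_mean_ext; intros t; destruct (g t) as [x y].
  apply injective_projections; simpl; ring.
- rewrite re_mean_plus, !re_mean_scal; [simpl; ring|..];
    repeat apply Rcont_scal; assumption.
Qed.

Lemma Cmean_scal (c : C) (g : R -> C) :
  Rcont g -> Cmean (fun t => c * g t)%C = (c * Cmean g)%C.
Proof.
intros Hg; apply injective_projections.
- apply re_mean_cscal, Hg.
- simpl (snd (Cmean _)).
  rewrite (re_mean_ext _ (fun t => (- Ci * c) * g t)%C) by (intros; ring).
  rewrite re_mean_cscal by exact Hg.
  destruct c as [a b]; destruct (Cmean g) as [x y]; simpl; ring.
Qed.

Lemma Rcont_Cmod (g : R -> C) : Rcont g -> Rcont (fun t => RtoC (Cmod (g t))).
Proof.
intros Hg t; apply Rcont_at_eps; intros e He.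
destruct (proj1 (Rcont_at_eps _ _) (Hg t) e He) as [d [P H]]; exists d; split; [exact P|].
intros s Hs; rewrite <- RtoC_minus, Cmod_R.
apply Rle_lt_trans with (1 := Cmod_lipschitz _ _), H, Hs.
Qed.

Lemma re_mean_mult_bound (g h : R -> C) (b : R) :
  Rcont g -> Rcont h -> (forall t, Cmod (h t) <= b) ->
  Rabs (re_mean (fun t => g t * h t)%C) <= b * re_mean (fun t => RtoC (Cmod (g t))).
Proof.
intros Hg Hh H; assert (Ha := Rcont_Cmod g Hg).
assert (P : forall t, Rabs (Re (g t * h t)) <= b * Cmod (g t)).
{ intros t; apply Rle_trans with (1 := re_le_Cmod _).
  rewrite Cmod_mult, Rmult_comm; apply Rmult_le_compat_r; [apply Cmod_ge_0|apply H]. }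
assert (Q : forall k t, Re (RtoC k * RtoC (Cmod (g t))) = k * Cmod (g t))
  by (intros; simpl; ring).
apply Rabs_le; split.
- replace (- (b * re_mean (fun t => RtoC (Cmod (g t)))))
    with ((- b) * re_mean (fun t => RtoC (Cmod (g t)))) by ring.
  rewrite <- re_mean_scal by exact Ha.
  apply re_mean_le; [apply Rcont_scal, Ha|apply Rcont_mult; assumption|].
  intros t; rewrite Q; specialize (P t); apply Rabs_le_between in P; lra.
- rewrite <- re_mean_scal by exact Ha.
  apply re_mean_le; [apply Rcont_mult; assumption|apply Rcont_scal, Ha|].
  intros t; rewrite Q; specialize (P t); apply Rabs_le_between in P; lra.
Qed.

(** The factor 2 comes from bounding a modulus by |Re| + |Im|. It is harmless here, since the bound
    only feeds a geometric decay. *)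
Lemma Cmean_mult_bound (g h : R -> C) (b : R) :
  Rcont g -> Rcont h -> (forall t, Cmod (h t) <= b) ->
  Cmod (Cmean (fun t => g t * h t)%C) <= 2 * b * re_mean (fun t => RtoC (Cmod (g t))).
Proof.
intros Hg Hh H; apply Rle_trans with (1 := Cmod_le_Re_Im _); simpl.
assert (A := re_mean_mult_bound g h b Hg Hh H).
assert (B := re_mean_mult_bound g (fun t => - Ci * h t)%C b Hg (Rcont_scal _ _ Hh)).
rewrite (re_mean_ext (fun t => - Ci * (g t * h t))%C (fun t => g t * (- Ci * h t))%C)
  by (intros; ring).
assert (B' : forall t, Cmod (- Ci * h t) <= b).
{ intros t; rewrite Cmod_mult, Cmod_opp, Cmod_Ci, Rmult_1_l; apply H. }
specialize (B B'); lra.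
Qed.

Lemma Cseries_geometric_error (u : nat -> C) (l : C) (M q : R) :
  0 <= q < 1 -> (forall n, Cmod (l - @sum_n C_AbelianMonoid u n) <= M * q ^ n) -> Cseries u l.
Proof.
intros Hq H; apply filterlim_locally; intros [e He].
assert (L : is_lim_seq (fun n => M * q ^ n) 0).
{ replace (Finite 0) with (Rbar_mult M 0) by (simpl; f_equal; ring).
  apply is_lim_seq_scal_l, is_lim_seq_geom; rewrite Rabs_pos_eq; lra. }
destruct (proj1 (filterlim_locally _ _) L (mkposreal e He)) as [N HN].
exists N; intros n Hn; apply C_NormedModule_mixin_compat1.
change (Cmod (@sum_n C_AbelianMonoid u n - l) < e).
rewrite Cmod_minus_sym; apply Rle_lt_trans with (1 := H n).
specialize (HN n Hn); change (Rabs (M * q ^ n - 0) < e) in HN.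
apply Rabs_lt_between in HN; lra.
Qed.

(** * Geometric expansion of the Cauchy kernel *)

Section Circle.
Variables (z : C) (r : R).
Hypothesis Hr : 0 < r.
Hypothesis Hz : Cmod z < r.

Let w (t : R) : C := (RtoC r * expi t)%C.

Lemma circle_neq_0 (t : R) : w t <> 0%R.
Proof.
apply Cmult_neq_0; [|apply expi_neq_0]; intro K; apply RtoC_inj in K; lra.
Qed.

Lemma circle_mod (t : R) : Cmod (w t) = r.
Proof. unfold w; rewrite Cmod_mult, expi_mod, Cmod_R, Rabs_pos_eq; lra. Qed.

Lemma circle_minus_neq_0 (t : R) : (w t - z)%C <> 0%R.
Proof.
apply Cmod_gt_0; assert (H := Cmod_minus_ge (w t) z); rewrite circle_mod in H; lra.
Qed.

Lemma Rcont_circle : Rcont w.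
Proof. apply Rcont_scal; intros t; apply Rcont_at_expi. Qed.

Lemma Rcont_circle_inv_pow (n : nat) : Rcont (fun t => (/ w t) ^ n)%C.
Proof.
intros t; apply Rcont_at_pow, Rcont_at_inv; [apply Rcont_circle|apply circle_neq_0].
Qed.

(** The numerator w reflects dw / (2 pi i) = w dt / (2 pi), so means against this kernel are Cauchy
    integrals. *)
Definition cauchy_kernel (t : R) : C := (w t / (w t - z))%C.

Lemma Rcont_cauchy_kernel : Rcont cauchy_kernel.
Proof.
apply Rcont_mult; [apply Rcont_circle|]; intros t.
apply (Rcont_at_inv (fun s => w s - z)%C); [|apply circle_minus_neq_0].
apply Rcont_plus; [apply Rcont_circle|apply Rcont_const].
Qed.

(** Iterating kernel = 1 + (z/w) kernel gives a finite geometric sum with an exact remainder of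
    order (|z|/r)^(n+1). No interchange of an infinite sum with an integral is needed. *)
Lemma Cseries_cauchy_kernel (g : R -> C) : Rcont g ->
  Cseries (fun n => Cmean (fun t => g t * (/ w t) ^ n) * z ^ n)%C
     (Cmean (fun t => g t * cauchy_kernel t)%C).
Proof.
intros Hg; assert (Z0 := Cmod_ge_0 z).
set (rem := fun n => Cmean (fun t => g t * ((/ w t) ^ n * cauchy_kernel t))%C).
assert (Hk : forall n, Rcont (fun t => (/ w t) ^ n * cauchy_kernel t)%C)
  by (intros n; apply Rcont_mult; [apply Rcont_circle_inv_pow|apply Rcont_cauchy_kernel]).
assert (Step : forall n, rem n =
   (Cmean (fun t => g t * (/ w t) ^ n) + z * rem (S n))%C).
{ intros n; unfold rem.
  rewrite <- Cmean_scal by (apply Rcont_mult; [exact Hg|apply Hk]).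
  rewrite <- Cmean_plus.
  - apply Cmean_ext; intros t; unfold cauchy_kernel; simpl Cpow; field.
    split; [apply circle_minus_neq_0|apply circle_neq_0].
  - apply Rcont_mult; [exact Hg|apply Rcont_circle_inv_pow].
  - apply Rcont_scal, Rcont_mult; [exact Hg|apply Hk]. }
assert (Sum : forall n, Cmean (fun t => g t * cauchy_kernel t)%C =
   (@sum_n C_AbelianMonoid (fun n => Cmean (fun t => g t * (/ w t) ^ n) * z ^ n)%C n
     + z ^ S n * rem (S n))%C).
{ intros n; transitivity (rem 0%nat).
  { apply Cmean_ext; intros t; simpl; ring. }
  induction n as [|n IH].
  - rewrite sum_O, (Step 0%nat); simpl; ring.
  - rewrite sum_Sn, IH, (Step (S n)).
    change (plus ?a ?b) with (a + b)%C; simpl Cpow; ring. }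
set (A := re_mean (fun t => RtoC (Cmod (g t)))).
assert (q0 : 0 <= Cmod z / r < 1).
{ split; [apply Rdiv_le_0_compat; lra|].
  apply Rmult_lt_reg_r with r; [lra|].
  unfold Rdiv; rewrite Rmult_assoc, Rinv_l; lra. }
assert (A0 : 0 <= A).
{ unfold A; apply Rle_trans with (re_mean (fun _ => 0%R)).
  - rewrite re_mean_const; simpl; lra.
  - apply re_mean_le; [apply Rcont_const|apply Rcont_Cmod, Hg|].
    intros t; simpl; apply Cmod_ge_0. }
set (b := r / (r - Cmod z)).
assert (b0 : 0 < b) by (apply Rdiv_lt_0_compat; lra).
assert (Kb : forall t, Cmod (cauchy_kernel t) <= b).
{ intros t; unfold cauchy_kernel, b.
  rewrite Cmod_div by apply circle_minus_neq_0; rewrite circle_mod.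
  assert (H := Cmod_minus_ge (w t) z); rewrite circle_mod in H.
  apply Rmult_le_compat_l; [lra|]; apply Rinv_le_contravar; lra. }
apply Cseries_geometric_error with (M := 2 * b * A) (q := Cmod z / r); [exact q0|].
intros n; rewrite (Sum n).
set (s := @sum_n C_AbelianMonoid _ n).
replace (s + z ^ S n * rem (S n) - s)%C with (z ^ S n * rem (S n))%C by ring.
rewrite Cmod_mult, Cmod_pow.
assert (Rb : Cmod (rem (S n)) <= 2 * (/ r ^ S n * b) * A).
{ apply Cmean_mult_bound; [exact Hg|apply Hk|]; intros t.
  rewrite Cmod_mult, Cmod_pow, Cmod_inv, circle_mod, pow_inv by apply circle_neq_0.
  apply Rmult_le_compat_l; [|apply Kb].
  left; apply Rinv_0_lt_compat, pow_lt, Hr. }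
apply Rle_trans with (Cmod z ^ S n * (2 * (/ r ^ S n * b) * A)).
- apply Rmult_le_compat_l; [apply pow_le, Z0|exact Rb].
- replace (Cmod z ^ S n * (2 * (/ r ^ S n * b) * A))
    with (2 * b * A * (Cmod z / r) ^ S n).
  2:{ unfold Rdiv; rewrite Rpow_mult_distr, pow_inv; ring. }
  apply Rmult_le_compat_l.
  + apply Rmult_le_pos; [lra|exact A0].
  + simpl; rewrite <- (Rmult_1_l ((Cmod z / r) ^ n)) at 2.
    apply Rmult_le_compat_r; [apply pow_le|]; lra.
Qed.

(** In the expansion for g = 1 only the constant term survives, as negative powers of w have mean
    0. *)
Lemma Cmean_cauchy_kernel : Cmean cauchy_kernel = 1.
Proof.
assert (H := Cseries_cauchy_kernel (fun _ => RtoC 1) (Rcont_const _)).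
rewrite (Cmean_ext _ cauchy_kernel) in H by (intros t; ring).
apply (Cseries_unique _ _ _ H), Cseries_cons.
assert (C0 : (Cmean (fun t => 1 * (/ w t) ^ 0) * z ^ 0)%C = 1).
{ rewrite (Cmean_ext _ (fun _ => RtoC 1)) by (intros t; simpl; ring).
  replace (Cmean (fun _ => RtoC 1)) with (RtoC 1); [simpl; ring|].
  apply injective_projections; simpl; rewrite re_mean_const; simpl; ring. }
rewrite C0; replace (1 - 1)%C with (0 * Cmean cauchy_kernel)%C by ring.
apply Cseries_ext with (2 := Cseries_scal 0 _ _ H); intros n.
assert (Cn : Cmean (fun t => 1 * (/ w t) ^ S n)%C = 0).
{ assert (K : forall c t, (c * (/ w t) ^ S n = c * (/ RtoC r) ^ S n * (/ expi t) ^ S n)%C).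
  { intros c t; rewrite <- Cmult_assoc, <- Cpow_mult_l; f_equal; f_equal; unfold w; field.
    split; [apply expi_neq_0|intro K; apply RtoC_inj in K; lra]. }
  apply injective_projections; unfold Cmean, fst, snd.
  - rewrite (re_mean_ext _ _ (K 1%C)); apply re_mean_expi_pow_neg; lia.
  - transitivity (re_mean (fun t => - Ci * (/ w t) ^ S n)%C).
    + apply re_mean_ext; intros t; ring.
    + rewrite (re_mean_ext _ _ (K (- Ci)%C)); apply re_mean_expi_pow_neg; lia. }
rewrite Cn; ring.
Qed.

End Circle.

(** * Cauchy's formula and expansion in the whole disk *)

Section Taylor.
Variables (f f' : C -> C).
Hypothesis Hf : forall w, unit_disk w -> Cderiv f w (f' w).
Hypothesis Cf' : forall w, unit_disk w -> Ccont f' w.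

Definition circle_coef (r : R) (n : nat) : C :=
  Cmean (fun t => f (RtoC r * expi t) * (/ (RtoC r * expi t)) ^ n)%C.

Lemma circle_in_disk (r t : R) : 0 < r < 1 -> unit_disk (RtoC r * expi t).
Proof. intros Hr; unfold unit_disk; rewrite circle_mod; lra. Qed.

Lemma Rcont_on_circle (r : R) : 0 < r < 1 -> Rcont (fun t => f (RtoC r * expi t)).
Proof.
intros Hr t; apply Rcont_at_comp; [apply Rcont_circle|].
apply Cderiv_Ccont with (1 := Hf _ (circle_in_disk r t Hr)).
Qed.

(** The homotopy replaces f(w) by the constant f(z) in front of the kernel, which has mean 1. *)
Lemma cauchy_formula (z : C) (r : R) : 0 < r < 1 -> Cmod z < r ->
  Cmean (fun t => f (RtoC r * expi t) * cauchy_kernel z r t)%C = f z.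
Proof.
intros Hr Hz.
assert (Kc := Rcont_cauchy_kernel z r (proj1 Hr) Hz).
transitivity (Cmean (fun t => f z * cauchy_kernel z r t)%C).
2:{ rewrite Cmean_scal, Cmean_cauchy_kernel by (try apply Hr; assumption); ring. }
assert (Ek : forall k t, ((k * cauchy_kernel z r t) * (RtoC r * expi t - z)
               = k * (RtoC r * expi t))%C).
{ intros k t; unfold cauchy_kernel; field.
  apply circle_minus_neq_0; [apply Hr|exact Hz]. }
unfold Cmean; f_equal.
- apply (re_mean_homotopy f f' z 1 r); auto; [lra|].
  intros t; rewrite <- Ek; ring.
- rewrite (re_mean_ext (fun t => - Ci * (f (RtoC r * expi t) * cauchy_kernel z r t))%C
     (fun t => f (RtoC r * expi t) * (- Ci * cauchy_kernel z r t))%C) by (intros; ring).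
  rewrite (re_mean_ext (fun t => - Ci * (f z * cauchy_kernel z r t))%C
     (fun t => f z * (- Ci * cauchy_kernel z r t))%C) by (intros; ring).
  apply (re_mean_homotopy f f' z (- Ci) r); auto; [lra|].
  apply Rcont_scal, Kc.
Qed.

Lemma circle_taylor (r : R) (z : C) : 0 < r < 1 -> Cmod z < r ->
  Cseries (fun n => circle_coef r n * z ^ n)%C (f z).
Proof.
intros Hr Hz; rewrite <- (cauchy_formula z r Hr Hz).
apply Cseries_cauchy_kernel; [apply Hr|exact Hz|apply Rcont_on_circle, Hr].
Qed.

(** Both expansions are differentiated, which shifts the index. The function g is quantified after n
    so that the induction hypothesis applies to its derivative. *)
Lemma taylor_unique (n : nat) : forall (g : C -> C) (a b : nat -> C),
  taylor_coefficients g a -> taylor_coefficients g b -> a n = b n.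
Proof.
induction n as [|n IH]; intros g a b Ha Hb.
- now rewrite <- (taylor_at_0 g a Ha), (taylor_at_0 g b Hb).
- destruct (taylor_derivative g a Ha) as [g1 [T1 D1]].
  destruct (taylor_derivative g b Hb) as [g2 [T2 D2]].
  assert (T2' : taylor_coefficients g1 (derivative_coef b)).
  { intros z Hz; rewrite (Cderiv_unique g z _ _ (D1 z Hz) (D2 z Hz)); apply T2, Hz. }
  assert (E1 := IH g1 _ _ T1 T2'); unfold derivative_coef in E1.
  assert (N : RtoC (INR (S n)) <> 0%R).
  { intro K; apply RtoC_inj in K; assert (J := pos_INR n); rewrite S_INR in K; lra. }
  transitivity (/ RtoC (INR (S n)) * (RtoC (INR (S n)) * a (S n)))%C; [field; exact N|].
  rewrite E1; field; exact N.
Qed.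

(** Instead of deforming one circle into the other, both families of coefficients are seen to expand
    the same function f(r z) on the full disk. *)
Lemma circle_coef_const (r s : R) (n : nat) : 0 < r <= s -> s < 1 ->
  circle_coef r n = circle_coef s n.
Proof.
intros Hr Hs.
assert (P : RtoC r <> 0%R) by (intro K; apply RtoC_inj in K; lra).
assert (N := Cpow_nz _ n P).
assert (D : forall z, unit_disk z -> Cmod (RtoC r * z) < r).
{ intros z Hz; unfold unit_disk in Hz; rewrite Cmod_mult, Cmod_R, Rabs_pos_eq; nra. }
assert (T : forall s', r <= s' < 1 -> taylor_coefficients (fun z => f (RtoC r * z))
              (fun k => circle_coef s' k * RtoC r ^ k)%C).
{ intros s' Hs' z Hz; apply pseries_Cseries.
  apply Cseries_ext with (fun k => circle_coef s' k * (RtoC r * z) ^ k)%C.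
  - intros k; rewrite Cpow_mult_l; ring.
  - apply circle_taylor; [lra|]; specialize (D z Hz); lra. }
assert (E1 := taylor_unique n _ _ _ (T r ltac:(lra)) (T s ltac:(lra))); cbv beta in E1.
transitivity (circle_coef r n * RtoC r ^ n * / RtoC r ^ n)%C; [field; exact N|].
rewrite E1; field; exact N.
Qed.

Lemma taylor_of_derivative : taylor_coefficients f (circle_coef (/ 2)).
Proof.
intros z Hz; unfold unit_disk in Hz; apply pseries_Cseries.
assert (Z0 := Cmod_ge_0 z).
set (s := (1 + Cmod z) / 2).
apply Cseries_ext with (fun n => circle_coef s n * z ^ n)%C.
- intros n; rewrite (circle_coef_const (/ 2) s n); [reflexivity|unfold s; lra..].
- apply circle_taylor; unfold s; lra.
Qed.

End Taylor.

(** * Coefficients of Schwarz functions *)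

Lemma Cmod_sqr_RtoC (z : C) : RtoC (Cmod z ^ 2) = (z * Cconj z)%C.
Proof. exact (Cmod2_conj z). Qed.

Lemma Cmod_sqr_plus (x y : C) :
  Cmod (x + y) ^ 2 = Cmod x ^ 2 + Cmod y ^ 2 + 2 * Re (Cconj x * y).
Proof. rewrite !Cmod2_alt; destruct x, y; simpl; ring. Qed.

(** The hypothesis says that the matrix with rows (al, 0) and (be, al) is a contraction; a single
    test vector suffices. *)
Lemma contraction_coef_bound (al be : C) : Cmod al < 1 ->
  (forall u v, Cmod (al * u) ^ 2 + Cmod (be * u + al * v) ^ 2 <= Cmod u ^ 2 + Cmod v ^ 2) ->
  Cmod be + Cmod al ^ 2 <= 1.
Proof.
intros Ha H.
assert (a0 := Cmod_ge_0 al); assert (b0 := Cmod_ge_0 be).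
set (x := Cmod al ^ 2) in *.
assert (x1 : 0 <= x < 1) by (unfold x; nra).
set (s := / (1 - x)).
assert (s0 : 0 < s) by (apply Rinv_0_lt_compat; lra).
assert (sx : s * (1 - x) = 1) by (unfold s; field; lra).
(* With this v, be + al v = s be, so H becomes x + (s b)^2 <= 1 + x (s b)^2, where b = |be|, and
   hence s b <= 1. *)
specialize (H 1 (RtoC s * (Cconj al * be))%C).
replace (be * 1 + al * (RtoC s * (Cconj al * be)))%C with (RtoC s * be)%C in H.
2:{ replace (al * (RtoC s * (Cconj al * be)))%C with ((al * Cconj al) * RtoC s * be)%C by ring.
    rewrite <- Cmod_sqr_RtoC; fold x.
    replace (RtoC s) with (1 + RtoC x * RtoC s)%C at 1; [ring|].
    rewrite <- RtoC_mult, <- RtoC_plus; f_equal; lra. }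
rewrite !Cmod_mult, Cmod_conj, Cmod_1, Cmod_R, Rabs_pos_eq in H by lra.
set (b := Cmod be) in *.
replace ((Cmod al * 1) ^ 2) with x in H by (unfold x; ring).
replace ((s * (Cmod al * b)) ^ 2) with (x * (s * b) ^ 2) in H by (unfold x; ring).
assert (K : (s * b) ^ 2 <= 1).
{ apply Rmult_le_reg_r with (1 - x); lra. }
assert (L : s * b <= 1) by (assert (0 <= s * b) by nra; nra).
assert (s * b * (1 - x) <= 1 * (1 - x)) by (apply Rmult_le_compat_r; lra).
replace (s * b * (1 - x)) with (s * (1 - x) * b) in * by ring; rewrite sx in *; lra.
Qed.

Section Schwarz.
Variables (om om1 : C -> C).
Hypothesis Hom : forall w, unit_disk w -> Cderiv om w (om1 w).
Hypothesis Com : forall w, unit_disk w -> Ccont om1 w.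
Hypothesis om0 : om 0 = 0.
Hypothesis Bom : forall w, unit_disk w -> Cmod (om w) < 1.

Let c := circle_coef om (/ 2).

Lemma schwarz_coef_0 : c 0%nat = 0.
Proof. rewrite <- om0; symmetry; apply taylor_at_0, (taylor_of_derivative om om1); assumption. Qed.

(** On the circle |z| = r, [al] and [be] are the coefficients of e^(it) and e^(2it) in h = om (u + v
    e^(it)), and |h| <= |u + v e^(it)|. *)
Lemma schwarz_bessel (r : R) (u v : C) : 0 < r < 1 ->
  Cmod (c 1%nat * RtoC r * u) ^ 2
    + Cmod (c 2%nat * RtoC r ^ 2 * u + c 1%nat * RtoC r * v) ^ 2
  <= Cmod u ^ 2 + Cmod v ^ 2.
Proof.
intros Hr.
set (al := (c 1%nat * RtoC r * u)%C).
set (be := (c 2%nat * RtoC r ^ 2 * u + c 1%nat * RtoC r * v)%C).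
assert (Cr : forall n, c n = circle_coef om r n).
{ intros n; unfold c; destruct (Rle_or_lt r (/ 2)).
  - symmetry; apply (circle_coef_const om om1); auto; lra.
  - apply (circle_coef_const om om1); auto; lra. }
set (g := fun n t => (om (RtoC r * expi t) * (/ (RtoC r * expi t)) ^ n)%C).
assert (Hg : forall n, Rcont (g n)).
{ intros n; apply Rcont_mult; [apply (Rcont_on_circle om om1); assumption|].
  apply Rcont_circle_inv_pow, Hr. }
(* Coefficients of 2 conj(B) h in powers of 1/w, apart from the factor om, where B = al e^(it) + be
   e^(2it). Thus the mean of L only involves the coefficients of om of index 0, 1 and 2. *)
set (k0 := (2 * (Cconj al * v))%C).
set (k1 := (2 * ((Cconj al * u + Cconj be * v) * RtoC r))%C).
set (k2 := (2 * (Cconj be * u * RtoC r ^ 2))%C).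
set (L := fun t => (k0 * g 0%nat t + k1 * g 1%nat t + k2 * g 2%nat t)%C).
(* In real part this is |u + v e^(it)|^2 + |al + be e^(it)|^2; the cross terms have mean 0. *)
set (U := fun t => (RtoC (Cmod u ^ 2 + Cmod v ^ 2 + (Cmod al ^ 2 + Cmod be ^ 2))
                    + (2 * (Cconj u * v + Cconj al * be)) * expi t ^ 1)%C).
assert (rL : Rcont L) by (repeat apply Rcont_plus; apply Rcont_scal, Hg).
assert (HE1 : Rcont (fun t => (2 * (Cconj u * v + Cconj al * be)) * expi t ^ 1)%C).
{ apply Rcont_scal; intros t; apply Rcont_at_pow, Rcont_at_expi. }
assert (rU : Rcont U) by (apply Rcont_plus; [apply Rcont_const|exact HE1]).
assert (ML : re_mean L = 2 * (Cmod al ^ 2 + Cmod be ^ 2)).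
{ unfold L; rewrite !re_mean_plus by (repeat apply Rcont_plus; apply Rcont_scal, Hg).
  rewrite !re_mean_cscal by apply Hg.
  change (Cmean (g ?n)) with (circle_coef om r n); rewrite <- !Cr, schwarz_coef_0.
  transitivity (Re (2 * (al * Cconj al + be * Cconj be))).
  - rewrite <- !re_plus; f_equal; unfold k0, k1, k2, al, be; ring.
  - rewrite <- !Cmod_sqr_RtoC; simpl; ring. }
assert (MU : re_mean U = Cmod u ^ 2 + Cmod v ^ 2 + (Cmod al ^ 2 + Cmod be ^ 2)).
{ unfold U; rewrite re_mean_plus by (assumption || apply Rcont_const).
  rewrite re_mean_const, re_mean_expi_pow by lia; simpl; ring. }
assert (Main : re_mean L <= re_mean U).
{ apply re_mean_le; [exact rL|exact rU|]; intros t.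
  assert (N := expi_neq_0 t); assert (M := expi_mod t).
  assert (Nr : RtoC r <> 0%R) by (intro K; apply RtoC_inj in K; lra).
  assert (D : unit_disk (RtoC r * expi t)) by (apply circle_in_disk, Hr).
  set (h := (om (RtoC r * expi t) * (u + v * expi t))%C).
  set (B := ((al + be * expi t) * expi t)%C).
  assert (EL : L t = (2 * (Cconj B * h))%C).
  { unfold L, B, h, g, k0, k1, k2.
    rewrite !Cmult_conj, Cplus_conj, Cmult_conj, expi_conj; simpl Cpow; field.
    split; assumption. }
  assert (h1 : Cmod h ^ 2 <= Cmod (u + v * expi t) ^ 2).
  { unfold h; rewrite Cmod_mult; assert (K := Bom _ D).
    assert (K0 := Cmod_ge_0 (om (RtoC r * expi t))); assert (K1 := Cmod_ge_0 (u + v * expi t)).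
    apply pow_incr; split; [apply Rmult_le_pos; assumption|].
    rewrite <- (Rmult_1_l (Cmod (u + _))) at 2; apply Rmult_le_compat_r; lra. }
  assert (B1 : Cmod B ^ 2 = Cmod (al + be * expi t) ^ 2)
    by (unfold B; rewrite Cmod_mult, M; ring).
  (* Expanding the square gives 2 Re (conj(B) h) <= |h|^2 + |B|^2, a pointwise form of Bessel's
     inequality that is then averaged. *)
  assert (Hm : 0 <= Cmod (h + - B) ^ 2) by apply pow2_ge_0.
  rewrite Cmod_sqr_plus, Cmod_opp, B1 in Hm.
  rewrite !Cmod_sqr_plus, !Cmod_mult, M in *.
  assert (R1 : Re (Cconj h * - B) = - Re (Cconj B * h))
    by (destruct h, B; simpl; ring).
  rewrite R1 in Hm; rewrite EL; unfold U.
  replace (Re (2 * (Cconj B * h))) with (2 * Re (Cconj B * h))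
    by (simpl; ring).
  assert (R2 : Re (RtoC (Cmod u ^ 2 + Cmod v ^ 2 + (Cmod al ^ 2 + Cmod be ^ 2))
                + 2 * (Cconj u * v + Cconj al * be) * expi t ^ 1)
           = Cmod u ^ 2 + Cmod v ^ 2 + (Cmod al ^ 2 + Cmod be ^ 2)
             + 2 * Re (Cconj u * (v * expi t)) + 2 * Re (Cconj al * (be * expi t))).
  { generalize (Cmod u) (Cmod v) (Cmod al) (Cmod be) (expi t); intros; simpl; ring. }
  rewrite R2; lra. }
lra.
Qed.

(** Bessel's inequality is available only for r < 1, where it gives r |c1| <= 1 and r^2 (|c2| +
    |c1|^2) <= 1; L lets the factor tend to 1. The first bound makes |c1 r| < 1, as the contraction
    lemma demands. *)
Lemma schwarz_coef_bound : Cmod (c 1%nat) <= 1 /\ Cmod (c 2%nat) + Cmod (c 1%nat) ^ 2 <= 1.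
Proof.
assert (P1 := Cmod_ge_0 (c 1%nat)); assert (P2 := Cmod_ge_0 (c 2%nat)).
assert (L : forall x, 0 <= x -> (forall s, 0 < s < 1 -> s * x <= 1) -> x <= 1).
{ intros x x0 H; apply Rnot_lt_le; intros K.
  specialize (H ((1 + / x) / 2)).
  assert (I : / x * x = 1) by (apply Rinv_l; lra).
  assert (0 < / x) by (apply Rinv_0_lt_compat; lra).
  assert (/ x < 1) by nra.
  assert (J := H ltac:(lra)); nra. }
assert (H1 : Cmod (c 1%nat) <= 1).
{ apply L; [exact P1|]; intros s Hs.
  assert (B := schwarz_bessel s 0 1 Hs).
  replace (c 1%nat * RtoC s * 0)%C with (RtoC 0) in B by ring.
  replace (c 2%nat * RtoC s ^ 2 * 0 + c 1%nat * RtoC s * 1)%C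
    with (RtoC s * c 1%nat)%C in B by ring.
  rewrite Cmod_0, Cmod_1, Cmod_mult, Cmod_R, Rabs_pos_eq in B by lra.
  assert (0 <= s * Cmod (c 1%nat)) by (apply Rmult_le_pos; lra).
  nra. }
split; [exact H1|].
apply L; [assert (H := pow2_ge_0 (Cmod (c 1%nat))); lra|]; intros s Hs.
set (r := sqrt s).
assert (r2 : r * r = s) by (apply sqrt_sqrt; lra).
assert (r0 : 0 < r) by (apply sqrt_lt_R0; lra).
assert (r1 : r < 1) by nra.
assert (K := contraction_coef_bound (c 1%nat * RtoC r) (c 2%nat * RtoC r ^ 2)).
rewrite !Cmod_mult, Cmod_pow, Cmod_R, Rabs_pos_eq in K by lra.
rewrite <- r2.
assert (J := K ltac:(nra) (fun u v => schwarz_bessel r u v (conj r0 r1))).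
nra.
Qed.

End Schwarz.

(** * Coefficients of f in terms of the Schwarz function *)

Lemma unit_disk_0 : unit_disk 0.
Proof. unfold unit_disk; rewrite Cmod_0; lra. Qed.

Lemma unit_disk_ball (z w : C) : unit_disk z -> Cmod (w - z) < 1 - Cmod z -> unit_disk w.
Proof. unfold unit_disk; intros Hz Hw; assert (H := Cmod_minus_ge w z); lra. Qed.

Lemma Cderiv_ext_disk (f g : C -> C) (z l : C) : unit_disk z ->
  (forall w, unit_disk w -> f w = g w) -> Cderiv f z l -> Cderiv g z l.
Proof.
intros Hz H; apply Cderiv_ext_loc with (1 - Cmod z); [unfold unit_disk in Hz; lra|].
intros w Hw; apply H, (unit_disk_ball z), Hw; exact Hz.
Qed.

Lemma Ccont_ext_disk (f g : C -> C) (z : C) : unit_disk z ->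
  (forall w, unit_disk w -> f w = g w) -> Ccont f z -> Ccont g z.
Proof.
intros Hz H; apply Ccont_ext_loc with (1 - Cmod z); [unfold unit_disk in Hz; lra|].
intros w Hw; apply H, (unit_disk_ball z), Hw; exact Hz.
Qed.

Definition quotient_by_id (f : C -> C) (v z : C) : C :=
  if Ceq_dec z 0 then v else (f z / z)%C.

Lemma taylor_quotient_by_id (f : C -> C) (a : nat -> C) :
  taylor_coefficients f a -> a 0%nat = 0 ->
  taylor_coefficients (quotient_by_id f (a 1%nat)) (fun n => a (S n)).
Proof.
intros Ha a0 z Hz; apply pseries_Cseries.
assert (S := Cseries_tail _ _ (proj1 (pseries_Cseries _ _ _) (Ha z Hz))).
unfold quotient_by_id; destruct (Ceq_dec z 0) as [E|N].
- apply Cseries_cons; rewrite E in *.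
  replace (a 1%nat - a 1%nat * 0 ^ 0)%C with (0 * (f 0 - a 0%nat * 0 ^ 0))%C
    by (simpl; ring).
  apply Cseries_ext with (2 := Cseries_scal 0 _ _ S); intros n; simpl; ring.
- replace (f z / z)%C with (/ z * (f z - a 0%nat * z ^ 0))%C
    by (rewrite a0; simpl; field; exact N).
  apply Cseries_ext with (2 := Cseries_scal (/ z) _ _ S).
  intros n; simpl; field; exact N.
Qed.

Lemma Cdiv_0_r (z : C) : (z / 0)%C = 0.
Proof.
unfold Cdiv, Cinv; destruct z; apply injective_projections; simpl; unfold Rdiv; ring.
Qed.

Section StarlikeRelation.
Variables (f om om1 : C -> C) (a : nat -> C).
Hypothesis Ha : taylor_coefficients f a.
Hypothesis f0 : f 0 = 0.
Hypothesis f'0 : C_derive f 0 = 1.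
Hypothesis Hom : forall w, unit_disk w -> Cderiv om w (om1 w).
Hypothesis om0 : om 0 = 0.
Hypothesis Bom : forall w, unit_disk w -> unit_disk (om w).
Hypothesis Hq : forall w, unit_disk w -> starlike_quotient f w = psi_AP (om w).

(** With F = f/z the relation reads F + z F' = F psi(om), free of division and valid at 0; the last
    equation is its derivative. Differentiability of F2 makes it continuous and allows one more
    differentiation at 0. *)
Lemma starlike_second_order : exists F F1 F2 : C -> C,
  F 0 = 1 /\ F1 0 = a 2%nat /\ F2 0 = (2 * a 3%nat)%C /\
  (forall z, unit_disk z -> F z <> 0%R /\ Cderiv F z (F1 z) /\ Cderiv F1 z (F2 z) /\
     (exists l, Cderiv F2 z l) /\
     (2 * F1 z + z * F2 z)%C
       = (F1 z * psi_AP (om z) + F z * (psi_AP' (om z) * om1 z))%C).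
Proof.
assert (a0 : a 0%nat = 0) by (rewrite <- (taylor_at_0 f a Ha); exact f0).
destruct (taylor_derivative f a Ha) as [f1 [Tf1 Df1]].
assert (a1 : a 1%nat = 1).
{ rewrite <- f'0, (Cderiv_C_derive _ _ _ (Df1 0%C unit_disk_0)).
  rewrite (taylor_at_0 _ _ Tf1); unfold derivative_coef; simpl; ring. }
set (F := quotient_by_id f (a 1%nat)).
assert (TF := taylor_quotient_by_id f a Ha a0); fold F in TF.
destruct (taylor_derivative _ _ TF) as [F1 [TF1 DF1]].
destruct (taylor_derivative _ _ TF1) as [F2 [TF2 DF2]].
destruct (taylor_derivative _ _ TF2) as [F3 [_ DF3]].
assert (F0 : F 0 = 1) by (rewrite (taylor_at_0 _ _ TF); exact a1).
assert (EF : forall z, f z = (z * F z)%C).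
{ intros z; unfold F, quotient_by_id; destruct (Ceq_dec z 0) as [->|N].
  - rewrite f0; ring.
  - field; exact N. }
assert (NF : forall z, unit_disk z -> F z <> 0%R).
{ intros z Hz K; destruct (Ceq_dec z 0) as [E|N].
  - rewrite E, F0 in K; exact (C1_nz K).
  (* A zero of F away from 0 would make the totalized quotient 0, a value that psi omits. *)
  - apply (psi_neq_0 (om z) (Bom z Hz)); rewrite <- (Hq z Hz).
    unfold starlike_quotient; destruct (Ceq_dec z 0); [contradiction|].
    rewrite EF, K, Cmult_0_r; apply Cdiv_0_r. }
assert (R1 : forall z, unit_disk z -> (F z + z * F1 z)%C = (F z * psi_AP (om z))%C).
{ intros z Hz.
  assert (D : f1 z = (F z + z * F1 z)%C).
  { apply (Cderiv_unique f z); [apply Df1, Hz|].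
    apply Cderiv_ext_disk with (1 := Hz) (f := fun w => (w * F w)%C).
    - intros w _; symmetry; apply EF.
    - apply Cderiv_eq with (2 := Cderiv_mult _ _ _ _ _ (Cderiv_id z) (DF1 z Hz)); ring. }
  assert (Q := Hq z Hz); unfold starlike_quotient in Q.
  destruct (Ceq_dec z 0) as [E|N].
  - rewrite <- Q, E; ring.
  - rewrite <- Q, (Cderiv_C_derive _ _ _ (Df1 z Hz)), <- D, EF; field.
    split; [apply NF, Hz|exact N]. }
exists F, F1, F2; split; [exact F0|]; split; [|split].
- rewrite (taylor_at_0 _ _ TF1); unfold derivative_coef; simpl; ring.
- rewrite (taylor_at_0 _ _ TF2); unfold derivative_coef; simpl INR; rewrite RtoC_plus; ring.
- intros z Hz; split; [apply NF, Hz|]; split; [apply DF1, Hz|]; split; [apply DF2, Hz|].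
  split; [eexists; apply DF3, Hz|].
  assert (DL := Cderiv_plus _ _ _ _ _ (DF1 z Hz)
                 (Cderiv_mult _ _ _ _ _ (Cderiv_id z) (DF2 z Hz))).
  assert (DR := Cderiv_mult _ _ _ _ _ (DF1 z Hz)
                 (Cderiv_comp _ _ _ _ _ (Hom z Hz) (Cderiv_psi _ (Bom z Hz)))).
  rewrite <- (Cderiv_unique _ _ _ _ (Cderiv_ext_disk _ _ _ _ Hz R1 DL) DR); ring.
Qed.

(** The differentiated relation is linear in [om1], with nonvanishing coefficient F psi'(om), and
    every other term in it is continuous. *)
Lemma starlike_omega_C1 (z : C) : unit_disk z -> Ccont om1 z.
Proof.
intros Hz; destruct starlike_second_order as [F [F1 [F2 [_ [_ [_ H]]]]]].
assert (N : forall w, unit_disk w -> (F w * psi_AP' (om w))%C <> 0%R).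
{ intros w Hw; apply Cmult_neq_0; [apply H, Hw|apply psi'_neq_0, Bom, Hw]. }
apply Ccont_ext_disk with (1 := Hz)
  (f := fun w => ((2 * F1 w + w * F2 w - F1 w * psi_AP (om w))
                   * / (F w * psi_AP' (om w)))%C).
- intros w Hw; destruct (H w Hw) as [_ [_ [_ [_ R]]]]; rewrite R.
  assert (K := N w Hw).
  assert (K1 : F w <> 0%R) by (apply H, Hw).
  assert (K2 := psi'_neq_0 _ (Bom w Hw)); field; split; assumption.
- destruct (H z Hz) as [_ [D0 [D1 [[l D2] _]]]].
  assert (Do := Cderiv_Ccont _ _ _ (Hom z Hz)).
  apply Ccont_mult.
  + apply Ccont_plus; [apply Ccont_plus; apply Ccont_mult|].
    * apply Ccont_const.
    * apply Cderiv_Ccont with (1 := D1).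
    * apply Ccont_id.
    * apply Cderiv_Ccont with (1 := D2).
    * apply (Ccont_comp (fun w => F1 w * psi_AP (om w))%C Copp).
      -- apply Ccont_mult; [apply Cderiv_Ccont with (1 := D1)|].
         apply Ccont_comp; [exact Do|apply Cderiv_Ccont with (1 := Cderiv_psi _ (Bom z Hz))].
      -- apply Cderiv_Ccont with (1 := Cderiv_opp _ _ _ (Cderiv_id _)).
  + apply (Ccont_comp (fun w => F w * psi_AP' (om w))%C Cinv); [|apply Ccont_Cinv, N, Hz].
    apply Ccont_mult; [apply Cderiv_Ccont with (1 := D0)|].
    apply Ccont_comp; [exact Do|apply Cderiv_Ccont with (1 := Cderiv_psi' _ (Bom z Hz))].
Qed.

Lemma starlike_coefficients (c1 c2 : C) :
  om1 0 = c1 -> Cderiv om1 0 (2 * c2)%C ->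
  a 2%nat = (RtoC (3 / 2) * c1)%C /\
  a 3%nat = (RtoC (3 / 4) * c2 + RtoC (25 / 16) * (c1 * c1))%C.
Proof.
intros V1 V2; destruct starlike_second_order as [F [F1 [F2 [E0 [E1 [E2 H]]]]]].
destruct (H 0%C unit_disk_0) as [_ [D0 [D1 [[l D2] R]]]].
assert (N4 : RtoC 4 <> 0%R) by (intro K; apply RtoC_inj in K; lra).
assert (N16 : RtoC 16 <> 0%R) by (intro K; apply RtoC_inj in K; lra).
assert (A2 : a 2%nat = (RtoC (3 / 2) * c1)%C).
{ rewrite om0, psi_0, psi'_0, E0, E1, E2, V1 in R.
  transitivity (2 * a 2%nat + 0 * (2 * a 3%nat) - a 2%nat * 1)%C; [ring|].
  rewrite R; ring. }
split; [exact A2|].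
assert (Dom := Hom 0%C unit_disk_0); rewrite V1 in Dom.
assert (Dp := Cderiv_psi 0%C unit_disk_0); assert (Dp' := Cderiv_psi'_0).
rewrite <- om0 in Dp, Dp'.
assert (DL := Cderiv_plus _ _ _ _ _ (Cderiv_mult _ _ _ _ _ (Cderiv_const 2 0) D1)
                (Cderiv_mult _ _ _ _ _ (Cderiv_id 0) D2)).
assert (DR := Cderiv_plus _ _ _ _ _
   (Cderiv_mult _ _ _ _ _ D1 (Cderiv_comp _ _ _ _ _ Dom Dp))
   (Cderiv_mult _ _ _ _ _ D0
      (Cderiv_mult _ _ _ _ _ (Cderiv_comp _ _ _ _ _ Dom Dp') V2))).
assert (U := Cderiv_unique _ _ _ _
  (Cderiv_ext_disk _ _ _ _ unit_disk_0 (fun w Hw => proj2 (proj2 (proj2 (proj2 (H w Hw))))) DL) DR).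
cbv beta in U; rewrite !om0, psi_0, psi'_0, E0, E1, E2, V1, A2 in U.
set (x := a 3%nat) in *.
rewrite !RtoC_div in * by lra.
(* At 0 the derivative of the left side is 6 a3, and F''(0) psi(0) = 2 a3 on the right moves over,
   leaving 4 a3 = 3 c2 + (25/4) c1^2. *)
transitivity ((0 * (RtoC 3 / 2 * c1) + 2 * (2 * x) + (1 * (2 * x) + 0 * l)
                - 2 * x) / 4)%C; [field; exact N4|].
rewrite U; field; repeat split; try assumption; exact two_C_neq_0.
Qed.

End StarlikeRelation.

(** * Extremal functions and the bounds *)

Lemma taylor_antiderivative (q : C -> C) (b : nat -> C) :
  taylor_coefficients q b ->
  exists h : C -> C, h 0 = 0 /\ forall z, unit_disk z -> Cderiv h z (q z).
Proof.
intros Hb.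
set (a := fun n => match n with O => RtoC 0 | S m => (b m / RtoC (INR (S m)))%C end).
assert (I : forall n, RtoC (INR (S n)) <> 0%R).
{ intros n K; apply RtoC_inj in K; assert (J := pos_INR n); rewrite S_INR in K; lra. }
assert (Ex : forall z, unit_disk z -> exists l, Cseries (fun n => a n * z ^ n)%C l).
{ intros z Hz; unfold unit_disk in Hz; assert (Z0 := Cmod_ge_0 z).
  set (r := (1 + Cmod z) / 2).
  destruct (taylor_coef_bound q b r Hb) as [B [B0 HB]]; [unfold r; lra|].
  assert (Hr : 0 < r) by (unfold r; lra).
  assert (Hz' : Cmod z < r) by (unfold r; lra).
  set (x := Cmod z / r).
  assert (Hx : 0 <= x < 1).
  { unfold x; split; [apply Rdiv_le_0_compat; lra|].
    apply Rmult_lt_reg_r with r; [lra|].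
    unfold Rdiv; rewrite Rmult_assoc, Rinv_l; lra. }
  assert (G : exists l, Cseries (fun n => a (S n) * z ^ S n)%C l).
  { apply ex_Cseries_le with (fun n => B * x ^ n).
    2:{ exists (B * / (1 - x)).
        apply (is_series_scal_l (V := R_NormedModule) B), is_series_geom.
        rewrite Rabs_pos_eq; lra. }
    intros n; unfold a.
    assert (J : 1 <= INR (S n)) by (rewrite S_INR; assert (K := pos_INR n); lra).
    rewrite Cmod_mult, Cmod_div by apply I.
    rewrite Cmod_pow, Cmod_R, Rabs_pos_eq by lra.
    replace (B * x ^ n) with (B / r ^ n * Cmod z ^ n)
      by (unfold x, Rdiv; rewrite Rpow_mult_distr, pow_inv; ring).
    assert (b0 := Cmod_ge_0 (b n)).
    apply Rmult_le_compat.
    - apply Rdiv_le_0_compat; lra.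
    - apply pow_le, Z0.
    - apply Rle_trans with (2 := HB n).
      rewrite <- (Rdiv_1_r (Cmod (b n))) at 2.
      apply Rmult_le_compat_l; [exact b0|]; apply Rinv_le_contravar; lra.
    - simpl; rewrite <- (Rmult_1_l (Cmod z ^ n)) at 2.
      apply Rmult_le_compat_r; [apply pow_le, Z0|lra]. }
  destruct G as [l Hl]; exists (l + a 0%nat * z ^ 0)%C; apply Cseries_cons.
  replace (l + a 0%nat * z ^ 0 - a 0%nat * z ^ 0)%C with l by ring; exact Hl. }
(* [iota] selects the unique sum; where the series diverges the value is unspecified. *)
set (h := fun z : C => @iota C_CompleteNormedModule (Cseries (fun n => a n * z ^ n)%C)).
assert (Th : taylor_coefficients h a).
{ intros z Hz; apply pseries_Cseries.
  apply (@iota_correct C_AbsRing C_CompleteNormedModule (Cseries (fun n => a n * z ^ n)%C)).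
  destruct (Ex z Hz) as [l Hl]; exists l; split; [exact Hl|].
  intros m Hm; exact (Cseries_unique _ _ _ Hl Hm). }
destruct (taylor_derivative h a Th) as [h1 [T1 D1]].
exists h; split; [exact (taylor_at_0 h a Th)|]; intros z Hz.
replace (q z) with (h1 z); [apply D1, Hz|].
apply (Cseries_unique (fun n => b n * z ^ n)%C); [|apply pseries_Cseries, Hb, Hz].
apply Cseries_ext with (2 := proj1 (pseries_Cseries _ _ _) (T1 z Hz)); intros n.
unfold derivative_coef, a; field; apply I.
Qed.

Lemma Cderiv_analytic (f f' : C -> C) :
  (forall z, unit_disk z -> Cderiv f z (f' z)) -> analytic_on_disk f.
Proof. intros H z Hz; exists (f' z); apply Cderiv_is_derive, H, Hz. Qed.

(** For f = z exp(h) the quotient z f'/f is 1 + z h', so h' = (psi(om) - 1)/z is prescribed. Then f'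
    = exp(h) psi(om) is visibly continuous, which gives f its Taylor series. *)
Lemma starlike_function_exists (om om1 : C -> C) :
  (forall w, unit_disk w -> Cderiv om w (om1 w)) ->
  (forall w, unit_disk w -> Ccont om1 w) -> om 0 = 0 ->
  (forall w, unit_disk w -> unit_disk (om w)) ->
  exists f a, class_A f /\ taylor_coefficients f a /\
    forall z, unit_disk z -> starlike_quotient f z = psi_AP (om z).
Proof.
intros Hom Com om0 Bom.
assert (DP : forall z, unit_disk z ->
  Cderiv (fun w => psi_AP (om w) - 1)%C z (psi_AP' (om z) * om1 z)%C).
{ intros z Hz; apply Cderiv_eq with (psi_AP' (om z) * om1 z - 0)%C; [ring|].
  apply Cderiv_minus; [|apply Cderiv_const].
  apply Cderiv_comp; [apply Hom, Hz|apply Cderiv_psi, Bom, Hz]. }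
assert (TP := taylor_of_derivative _ _ DP).
set (p := circle_coef (fun w => psi_AP (om w) - 1)%C (/ 2)) in TP.
assert (Tp : taylor_coefficients (fun w => psi_AP (om w) - 1)%C p).
{ apply TP; intros z Hz; apply Ccont_mult; [|apply Com, Hz].
  apply Ccont_comp; [apply Cderiv_Ccont with (1 := Hom z Hz)|].
  apply Cderiv_Ccont with (1 := Cderiv_psi' _ (Bom z Hz)). }
assert (P0 : psi_AP (om 0) = 1) by (rewrite om0; exact psi_0).
assert (p0 : p 0%nat = 0)
  by (rewrite <- (taylor_at_0 _ _ Tp), P0; ring).
destruct (taylor_antiderivative _ _ (taylor_quotient_by_id _ _ Tp p0)) as [h [h0 Dh]].
set (q := quotient_by_id (fun w => psi_AP (om w) - 1)%C (p 1%nat)) in *.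
assert (Eq : forall z, (1 + z * q z)%C = psi_AP (om z)).
{ intros z; unfold q, quotient_by_id; destruct (Ceq_dec z 0) as [->|N].
  - rewrite P0; ring.
  - field; exact N. }
set (f := fun z => (z * Cexp (h z))%C).
set (f' := fun z => (Cexp (h z) * psi_AP (om z))%C).
assert (Df : forall z, unit_disk z -> Cderiv f z (f' z)).
{ intros z Hz; apply Cderiv_eq with (2 := Cderiv_mult _ _ _ _ _ (Cderiv_id z)
    (Cderiv_comp _ _ _ _ _ (Dh z Hz) (Cderiv_Cexp (h z)))).
  unfold f'; rewrite <- Eq; ring. }
assert (Cf : forall z, unit_disk z -> Ccont f' z).
{ intros z Hz; apply Ccont_mult.
  - apply Ccont_comp; [apply Cderiv_Ccont with (1 := Dh z Hz)|apply Cderiv_Ccont with (1 := Cderiv_Cexp _)].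
  - apply Ccont_comp; [apply Cderiv_Ccont with (1 := Hom z Hz)|].
    apply Cderiv_Ccont with (1 := Cderiv_psi _ (Bom z Hz)). }
exists f, (circle_coef f (/ 2)); split; [split; [|split]|split].
- apply Cderiv_analytic with f', Df.
- unfold f; ring.
- rewrite (Cderiv_C_derive _ _ _ (Df 0%C unit_disk_0)); unfold f'.
  rewrite h0, P0, Cexp_0; ring.
- apply taylor_of_derivative with f'; assumption.
- intros z Hz; unfold starlike_quotient; destruct (Ceq_dec z 0) as [->|N]; [now rewrite P0|].
  rewrite (Cderiv_C_derive _ _ _ (Df z Hz)); unfold f, f'; field.
  split; [apply Cexp_neq_0|exact N].
Qed.

(** * Extremal Schwarz functions *)

Definition blaschke (c : R) (z : C) : C := (z * (RtoC c - z) / (1 - RtoC c * z))%C.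

Definition blaschke' (c : R) (z : C) : C :=
  ((RtoC c - 2 * z + RtoC c * z ^ 2) / (1 - RtoC c * z) ^ 2)%C.

Lemma blaschke_denominator (c : R) (z : C) :
  0 <= c <= 1 -> unit_disk z -> (1 - RtoC c * z)%C <> 0%R.
Proof.
intros Hc Hz; unfold unit_disk in Hz; apply Cmod_gt_0.
assert (H := Cmod_minus_ge 1 (RtoC c * z)); assert (Z0 := Cmod_ge_0 z).
rewrite Cmod_1, Cmod_mult, Cmod_R, Rabs_pos_eq in H by lra; nra.
Qed.

Lemma Cderiv_blaschke (c : R) (z : C) :
  0 <= c <= 1 -> unit_disk z -> Cderiv (blaschke c) z (blaschke' c z).
Proof.
intros Hc Hz; assert (N := blaschke_denominator c z Hc Hz).
apply Cderiv_eq with (2 := Cderiv_div _ (fun w => 1 - RtoC c * w)%C z _ _ N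
  (Cderiv_mult _ _ _ _ _ (Cderiv_id z) (Cderiv_minus _ _ _ _ _ (Cderiv_const (RtoC c) z) (Cderiv_id z)))
  (Cderiv_minus _ _ _ _ _ (Cderiv_const 1 z) (Cderiv_mult _ _ _ _ _ (Cderiv_const (RtoC c) z) (Cderiv_id z)))).
unfold blaschke'; field; exact N.
Qed.

Lemma Cderiv_blaschke' (c : R) (z : C) : 0 <= c <= 1 -> unit_disk z ->
  Cderiv (blaschke' c) z (2 * (RtoC c ^ 2 - 1) / (1 - RtoC c * z) ^ 3)%C.
Proof.
intros Hc Hz; assert (N := blaschke_denominator c z Hc Hz).
assert (Dd := Cderiv_minus _ _ _ _ _ (Cderiv_const 1 z)
                (Cderiv_mult _ _ _ _ _ (Cderiv_const (RtoC c) z) (Cderiv_id z))).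
assert (D2 := Cderiv_mult _ _ _ _ _ Dd (Cderiv_mult _ _ _ _ _ Dd (Cderiv_const 1 z))).
assert (Dn := Cderiv_plus _ _ _ _ _
  (Cderiv_minus _ _ _ _ _ (Cderiv_const (RtoC c) z) (Cderiv_mult _ _ _ _ _ (Cderiv_const 2 z) (Cderiv_id z)))
  (Cderiv_mult _ _ _ _ _ (Cderiv_const (RtoC c) z)
     (Cderiv_mult _ _ _ _ _ (Cderiv_id z) (Cderiv_mult _ _ _ _ _ (Cderiv_id z) (Cderiv_const 1 z))))).
assert (N2 : ((1 - RtoC c * z) * ((1 - RtoC c * z) * 1))%C <> 0%R).
{ apply Cmult_neq_0; [exact N|]; rewrite Cmult_1_r; exact N. }
apply Cderiv_eq with (2 := Cderiv_div _ (fun w => (1 - RtoC c * w) * ((1 - RtoC c * w) * 1))%C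
                         z _ _ N2 Dn D2).
field; exact N.
Qed.

(** The reason is |1 - c z|^2 - |c - z|^2 = (1 - c^2) (1 - |z|^2) >= 0. *)
Lemma blaschke_disk (c : R) (z : C) :
  0 <= c <= 1 -> unit_disk z -> unit_disk (blaschke c z).
Proof.
intros Hc Hz; assert (N := blaschke_denominator c z Hc Hz).
assert (P : 0 < Cmod (1 - RtoC c * z)) by (apply Cmod_gt_0; exact N).
assert (L : Cmod (RtoC c - z) <= Cmod (1 - RtoC c * z)).
{ apply Rsqr_incr_0; [|apply Cmod_ge_0|apply Cmod_ge_0].
  unfold unit_disk in Hz; assert (Z0 := Cmod_ge_0 z).
  assert (Z2 : Cmod z ^ 2 <= 1) by nra.
  rewrite !Rsqr_pow2, Cmod2_alt in *; rewrite Cmod2_alt.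
  destruct z as [x y]; simpl in *.
  assert (0 <= (1 - c * c) * (1 - (x * x + y * y))) by (apply Rmult_le_pos; nra).
  nra. }
unfold unit_disk, blaschke in *.
rewrite Cmod_div, Cmod_mult by exact N.
apply Rmult_lt_reg_r with (Cmod (1 - RtoC c * z)); [exact P|].
unfold Rdiv; rewrite Rmult_assoc, Rinv_l by lra.
assert (Z0 := Cmod_ge_0 z); assert (C0 := Cmod_ge_0 (RtoC c - z)); nra.
Qed.

(** * The determinant and its extreme values *)

Lemma T31_real (a : nat -> C) :
  T31 a = RtoC (2 * Re (a 2%nat * a 2%nat * Cconj (a 3%nat))%C
                - 2 * Cmod (a 2%nat) ^ 2 - Cmod (a 3%nat) ^ 2 + 1).
Proof.
rewrite !Cmod2_alt; unfold T31, det3; destruct (a 2%nat), (a 3%nat).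
apply injective_projections; simpl; ring.
Qed.

Lemma T31_schwarz (a : nat -> C) (c1 c2 : C) :
  a 2%nat = (RtoC (3 / 2) * c1)%C ->
  a 3%nat = (RtoC (3 / 4) * c2 + RtoC (25 / 16) * (c1 * c1))%C ->
  Re (T31 a) = 1 - 9 / 2 * Cmod c1 ^ 2 + 1175 / 256 * (Cmod c1 ^ 2) ^ 2
               + 33 / 32 * Re (c1 * c1 * Cconj c2) - 9 / 16 * Cmod c2 ^ 2.
Proof.
intros E2 E3; rewrite T31_real, E2, E3.
rewrite !Cmod2_alt; destruct c1, c2; simpl; field.
Qed.

(** Replacing rho by -x y leaves an expression decreasing in y, so y = 1 - x gives the minorant 7/16
    - (141/32) x + (1295/256) x^2, with vertex 564/1295 and value -676/1295. From above, rho <= x (1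
    - x) and y^2 >= 0 leave a convex quadratic in x, equal to 1 at 0 and to 279/256 at 1. *)
Lemma T31_bounds (x y rho : R) :
  0 <= x -> 0 <= y -> y + x <= 1 -> Rabs rho <= x * y ->
  - (676 / 1295) <= 1 - 9 / 2 * x + 1175 / 256 * x ^ 2 + 33 / 32 * rho - 9 / 16 * y ^ 2
    <= 279 / 256.
Proof.
intros Hx Hy Hxy Hr; apply Rabs_le_between in Hr.
assert (XY : x * y <= x * (1 - x)) by (apply Rmult_le_compat_l; lra).
split.
- assert (Y2 : y ^ 2 <= (1 - x) ^ 2) by (apply pow_incr; lra).
  assert (S := pow2_ge_0 (x - 564 / 1295)); nra.
- assert (0 <= y ^ 2) by apply pow2_ge_0.
  assert (0 <= x * (1 - x)) by (apply Rmult_le_pos; lra).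
  nra.
Qed.

(** Here c1 = c and c2 = c^2 - 1, so y = 1 - x and rho = -x y: the value is the minorant of
    [T31_bounds] at x = c^2. At c = 1 it also meets the upper bound, because y = 0 there. *)
Lemma T31_blaschke (c : R) : 0 <= c <= 1 ->
  exists f a, class_SAP f /\ taylor_coefficients f a /\
    T31 a = RtoC (7 / 16 - 141 / 32 * c ^ 2 + 1295 / 256 * (c ^ 2) ^ 2).
Proof.
intros Hc.
assert (D := fun z => Cderiv_blaschke c z Hc).
assert (B0 : blaschke c 0 = 0).
{ unfold blaschke; field; apply (blaschke_denominator c 0 Hc unit_disk_0). }
destruct (starlike_function_exists (blaschke c) (blaschke' c)) as [f [a [Hf [Ha Hq]]]].
- exact D.
- intros z Hz; apply Cderiv_Ccont with (1 := Cderiv_blaschke' c z Hc Hz).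
- exact B0.
- intros z; apply blaschke_disk, Hc.
- exists f, a; split; [|split; [exact Ha|]].
  + split; [exact Hf|]; exists (blaschke c); split; [|exact Hq].
    split; [apply Cderiv_analytic with (1 := D)|split; [exact B0|]].
    intros z Hz; exact (blaschke_disk c z Hc Hz).
  + destruct (starlike_coefficients f (blaschke c) (blaschke' c) a Ha
      (proj1 (proj2 Hf)) (proj2 (proj2 Hf)) D B0 (fun z => blaschke_disk c z Hc) Hq
      (RtoC c) (RtoC (c ^ 2 - 1))) as [A2 A3].
    * unfold blaschke'; field.
    * apply Cderiv_eq with (2 := Cderiv_blaschke' c 0 Hc unit_disk_0).
      rewrite RtoC_minus, RtoC_pow; field.
    * assert (R := T31_schwarz a _ _ A2 A3).
      assert (K : T31 a = RtoC (Re (T31 a))) by (rewrite T31_real; reflexivity).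
      rewrite K, R, !Cmod2_alt; f_equal; simpl; field.
Qed.

Theorem theorem7p1 :
  (forall (f : C -> C) (a : nat -> C),
     class_SAP f -> taylor_coefficients f a ->
     T31 a = RtoC (2 * Re (a 2%nat * a 2%nat * Cconj (a 3%nat))%C
                   - 2 * Cmod (a 2%nat) ^ 2 - Cmod (a 3%nat) ^ 2 + 1) /\
     - (676 / 1295) <= Re (T31 a) <= 279 / 256) /\
  (exists (f : C -> C) (a : nat -> C),
     class_SAP f /\ taylor_coefficients f a /\
     T31 a = RtoC (- (676 / 1295))) /\
  (exists (f : C -> C) (a : nat -> C),
     class_SAP f /\ taylor_coefficients f a /\
     T31 a = RtoC (279 / 256)).
Proof.
split; [|split].
- intros f a [[_ [f0 f'0]] [om [[Aom [om0 Bom]] Hq]]] Ha.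
  split; [apply T31_real|].
  assert (Hom : forall w, unit_disk w -> Cderiv om w (C_derive om w)).
  { intros w Hw; destruct (Aom w Hw) as [l Hl]; apply Cderiv_is_derive in Hl.
    now rewrite (Cderiv_C_derive _ _ _ Hl). }
  assert (Com := starlike_omega_C1 f om _ a Ha f0 f'0 Hom Bom Hq).
  assert (To := taylor_of_derivative om _ Hom Com).
  destruct (schwarz_coef_bound om _ Hom Com om0 Bom) as [B1 B2].
  set (c := circle_coef om (/ 2)) in *.
  (* The derivative is taken again from the series of om, so that its own derivative at 0 is known
     to be 2 c2. *)
  destruct (taylor_derivative om c To) as [om1 [T1 D1]].
  destruct (taylor_derivative om1 _ T1) as [om2 [T2 D2]].
  assert (V1 : om1 0 = c 1%nat).
  { rewrite (taylor_at_0 _ _ T1); unfold derivative_coef; simpl; ring. }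
  assert (V2 : Cderiv om1 0 (2 * c 2%nat)%C).
  { apply Cderiv_eq with (2 := D2 0%C unit_disk_0); rewrite (taylor_at_0 _ _ T2).
    unfold derivative_coef; simpl INR; rewrite RtoC_plus; ring. }
  destruct (starlike_coefficients f om om1 a Ha f0 f'0 D1 om0 Bom Hq _ _ V1 V2) as [A2 A3].
  rewrite (T31_schwarz a _ _ A2 A3).
  apply T31_bounds.
  + apply pow2_ge_0.
  + apply Cmod_ge_0.
  + exact B2.
  + apply Rle_trans with (1 := re_le_Cmod _).
    rewrite !Cmod_mult, Cmod_conj; right; ring.
(* Chosen so that c^2 is the vertex of the quadratic in [T31_blaschke]. *)
- set (c := sqrt (564 / 1295)).
  assert (c2 : c ^ 2 = 564 / 1295) by (unfold c; rewrite pow2_sqrt; lra).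
  assert (c0 : 0 <= c) by apply sqrt_pos.
  destruct (T31_blaschke c) as [f [a [Hf [Ha HT]]]]; [split; nra|].
  exists f, a; repeat split; try apply Hf; try exact Ha.
  rewrite HT, c2; f_equal; field.
- destruct (T31_blaschke 1) as [f [a [Hf [Ha HT]]]]; [lra|].
  exists f, a; repeat split; try apply Hf; try exact Ha.
  rewrite HT; f_equal; field.
Qed.
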